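(* Let $\mathcal A$ be a line arrangement in $\mathbb{CP}^2$. Suppose there exists an intersection point $p$ of $\mathcal A$ such that $\bar m(p)>\frac12(|\mathcal A|-3)$, where $\bar m(p)$ is the number of lines of $\mathcal A$ passing through $p$. Then Terao's conjecture holds for $\mathcal A$: if $\mathcal B$ and $\mathcal B'$ are line arrangements in $\mathbb{CP}^2$ whose intersection lattices are both isomorphic to that of $\mathcal A$, and $\mathcal B$ is free, then $\mathcal B'$ is free.
   Context: A line arrangement $\mathcal A$ in $\mathbb{CP}^2$ is a finite set of distinct projective lines, equivalently a finite set of 2-dimensional linear subspaces $\ker\alpha_H$ ($H\in\mathcal A$) of $\mathbb C^3$. With $S=\mathbb C[x,y,z]$, $\mathcal A$ is called free if the $S$-module $D(\mathcal A)=\{\theta\in\mathrm{Der}_{\mathbb C}(S)\mid\theta(\alpha_H)\in\alpha_HS\ \text{for all }H\in\mathcal A\}$ is free. The intersection lattice of $\mathcal A$ is the set of all intersections of subfamilies of these subspaces of $\mathbb C^3$, ordered by reverse inclusion. An intersection point of $\mathcal A$ is a point of $\mathbb{CP}^2$ lying on at least two lines of $\mathcal A$. *)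

(* Defs.v *)
From HB Require Import structures.
From mathcomp Require Import all_boot all_order all_algebra.
From mathcomp Require Import finmap.
From mathcomp Require Import boolp classical_sets functions reals.
From mathcomp Require Import complex.
From mathcomp Require Import mpoly.

Set Implicit Arguments.
Unset Strict Implicit.
Unset Printing Implicit Defensive.

Import Order.TTheory GRing.Theory Num.Theory.

Local Open Scope ring_scope.

(* A submodule D of V is free when it has a basis B, finite or not; linear
   combinations are sums over duplicate-free finite sequences of elements
   of B. *)
Definition free_submodule (K : nzRingType) (V : lmodType K) (D : set V)
    : Prop :=
  exists B : set V,
    [/\ forall b, B b -> D b,
        forall (s : seq V) (c : V -> K), uniq s -> (forall b, b \in s -> B b) ->
          \sum_(b <- s) c b *: b = 0 -> forall b, b \in s -> c b = 0
      & forall v, D v -> exists (s : seq V) (c : V -> K),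
          [/\ uniq s, forall b, b \in s -> B b & v = \sum_(b <- s) c b *: b]].

Section Arrangements.
Variable R : realType.

Local Notation C := (R[i]%C).
Local Notation S := {mpoly C[3]}.
Local Notation E := 'rV[C]_3.

(* A line of CP^2 is a 2-dimensional subspace of C^3, a point of CP^2 a
   1-dimensional one. *)
Definition line_arrangement (A : {fset {vspace E}}) : Prop :=
  forall H, H \in A -> \dim H = 2%N.

(* A linear form alpha on C^3, seen as the polynomial
   alpha(e_0) X_0 + alpha(e_1) X_1 + alpha(e_2) X_2. *)
Definition mpoly_of_form (alpha : 'Hom(E, C^o)) : S :=
  \sum_(i < 3) (alpha (delta_mx 0 i) : C) *: 'X_i.

Definition derivation (theta : S -> S) : Prop :=
  linear theta /\
  forall f g : S, theta (f * g) = theta f * g + f * theta g.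

(* The forms alpha with kernel H are nonzero multiples of each other, so asking
   the divisibility for all of them or for a chosen one is the same. The
   codomain S^o is S seen as a module over itself, which makes the ambient
   function space an S-module for the pointwise operations. *)
Definition logder (A : {fset {vspace E}}) : set (S -> S^o) :=
  fun theta => derivation theta /\
    forall H, H \in A -> forall alpha : 'Hom(E, C^o), lker alpha = H ->
      exists g : S, theta (mpoly_of_form alpha) = mpoly_of_form alpha * g.

Definition free_arrangement (A : {fset {vspace E}}) : Prop :=
  @free_submodule S (S -> S^o) (logder A).

(* The empty subfamily contributes the whole space C^3. *)
Definition intersection_lattice (A : {fset {vspace E}}) : {fset {vspace E}} :=
  [fset (\bigcap_(H <- enum_fset B) H)%VS | B : {fset {vspace E}} in fpowerset A]%fset.

(* The order is reverse inclusion. *)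
Definition lattice_le (A : {fset {vspace E}}) (X Y : intersection_lattice A)
    : bool :=
  (val Y <= val X)%VS.

Definition lattice_isomorphic (A B : {fset {vspace E}}) : Prop :=
  exists phi : intersection_lattice A -> intersection_lattice B,
    bijective phi /\ forall X Y, lattice_le (phi X) (phi Y) = lattice_le X Y.

Definition multiplicity (A : {fset {vspace E}}) (p : {vspace E}) : nat :=
  #|` [fset H in A | (p <= H)%VS]%fset|.

Definition intersection_point (A : {fset {vspace E}}) (p : {vspace E}) : Prop :=
  \dim p = 1%N /\ (2 <= multiplicity A p)%N.

End Arrangements.

(* Main.v *)
Require Import Defs.
From HB Require Import structures.
From mathcomp Require Import all_boot all_order all_algebra.
From mathcomp Require Import finmap.
From mathcomp Require Import boolp classical_sets functions reals.
From mathcomp Require Import complex.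
From mathcomp Require Import mpoly.
From mathcomp Require Import fintype finset ring lra zify.

Import Order.TTheory GRing.Theory Num.Theory.

Local Open Scope ring_scope.

Set Implicit Arguments.
Unset Strict Implicit.
Unset Printing Implicit Defensive.

(** Let [p] be a point on [m] of the [n] lines, with [n <= 2m + 2]; the [m] lines
    form the pencil of [p], and [k = n - m] lines remain. A derivation is the
    triple of its values on the variables, and freeness is tested by Saito's
    criterion [saito]: there are two logarithmic derivations whose determinant
    with the Euler derivation is a nonzero constant times the product of the
    forms of the lines. The determinant of any basis has this shape up to a
    constant, its homogeneous components are determinants of logarithmic
    derivations again, and the Euler derivation can replace one member
    ([det_basis], [saito_of_basis], [saito_homog]); so the criterion characterizes
    freeness, [free_arrangement_saito].

    If all the points where two lines meet lie on lines of the pencil, the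
    arrangement is supersolvable, and free ([saito_supersolvable]).

    Otherwise suppose that the arrangement is free, with a homogeneous basis
    formed by the Euler derivation and two others, of degrees [d1 <= d2] with
    [d1 + d2 = n - 1]. For a logarithmic derivation [t], the determinant of the
    Euler derivation, the constant derivation towards [p] and [t] is divisible by
    the [m] forms of the pencil, and the quotient vanishes at each intersection
    point off the pencil. Comparing degrees, [n] is at least [2m + 1], [d1 = m],
    and the quotient for the derivation of degree [d1] is a nonzero linear form
    ([offpencil_linear]). The points off the pencil are thus collinear, so some
    line [h] carries exactly one of them ([line_with_one_point]), and [h] has
    [m + 1] intersection points, [m] of them on the pencil.

    For a line with that many points, freeness passes from the arrangement to
    the one without [h] and back ([saito_del], [saito_add]). These are the
    addition and deletion theorems; when the number of points is about half the
    number of lines they hold whatever the degrees are, since they only involve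
    the smaller degree, which is at most [(n - 1) / 2]. Induction on the number of
    lines follows ([saito_combinatorial]). It only speaks of triples of
    concurrent lines, and those are visible in the intersection lattice, where
    the lines are the atoms ([lattice_iso_lines]). *)

(** * Triples over a commutative ring *)

Definition o0 : 'I_3 := @Ordinal 3 0 isT.
Definition o1 : 'I_3 := @Ordinal 3 1 isT.
Definition o2 : 'I_3 := @Ordinal 3 2 isT.

Lemma ord3_ind (P : 'I_3 -> Prop) : P o0 -> P o1 -> P o2 -> forall i, P i.
Proof.
by move=> P0 P1 P2 [[|[|[|//]]] lti]; rewrite (bool_irrelevance lti isT).
Qed.

Lemma sum_ord3 (A : nmodType) (F : 'I_3 -> A) :
  \sum_i F i = F o0 + F o1 + F o2.
Proof.
rewrite !big_ord_recl big_ord0 addr0 addrA.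
by congr (F _ + F _ + F _); apply: val_inj.
Qed.

Lemma row3P (A : Type) (u v : 'rV[A]_3) :
  u 0 o0 = v 0 o0 -> u 0 o1 = v 0 o1 -> u 0 o2 = v 0 o2 -> u = v.
Proof. by move=> *; apply/rowP; apply: ord3_ind. Qed.

Section Triples.
Variable A : comNzRingType.
Implicit Types u v w x y z : 'rV[A]_3.

Definition dot u v : A := u 0 o0 * v 0 o0 + u 0 o1 * v 0 o1 + u 0 o2 * v 0 o2.

Definition cross u v : 'rV[A]_3 := \row_i
  [:: u 0 o1 * v 0 o2 - u 0 o2 * v 0 o1;
      u 0 o2 * v 0 o0 - u 0 o0 * v 0 o2;
      u 0 o0 * v 0 o1 - u 0 o1 * v 0 o0]`_i.

Definition det3 u v w : A := dot u (cross v w).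

Lemma crossE u v :
  (cross u v 0 o0 = u 0 o1 * v 0 o2 - u 0 o2 * v 0 o1) *
  (cross u v 0 o1 = u 0 o2 * v 0 o0 - u 0 o0 * v 0 o2) *
  (cross u v 0 o2 = u 0 o0 * v 0 o1 - u 0 o1 * v 0 o0).
Proof. by rewrite !mxE. Qed.

Lemma dotC u v : dot u v = dot v u.
Proof. by rewrite /dot; ring. Qed.

Lemma dotDr u v w : dot u (v + w) = dot u v + dot u w.
Proof. by rewrite /dot !mxE; ring. Qed.

Lemma dotNr u v : dot u (- v) = - dot u v.
Proof. by rewrite /dot !mxE; ring. Qed.

Lemma dotZr u c v : dot u (c *: v) = c * dot u v.
Proof. by rewrite /dot !mxE; ring. Qed.

Lemma dotZl c u v : dot (c *: u) v = c * dot u v.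
Proof. by rewrite dotC dotZr dotC. Qed.

Lemma det3_rot u v w : det3 u v w = det3 v w u.
Proof. by rewrite /det3 /dot !crossE; ring. Qed.

Lemma det3_swap u v w : det3 u v w = - det3 u w v.
Proof. by rewrite /det3 /dot !crossE; ring. Qed.

Lemma det3_dotr u v w : det3 u v w = dot (cross u v) w.
Proof. by rewrite /det3 /dot !crossE; ring. Qed.

Lemma det3Dr u v w x : det3 u v (w + x) = det3 u v w + det3 u v x.
Proof. by rewrite !det3_dotr dotDr. Qed.

Lemma det3Nr u v w : det3 u v (- w) = - det3 u v w.
Proof. by rewrite !det3_dotr dotNr. Qed.

Lemma det3Zr u v c w : det3 u v (c *: w) = c * det3 u v w.
Proof. by rewrite !det3_dotr dotZr. Qed.

Lemma det3Zm u v c w : det3 u (c *: v) w = c * det3 u v w.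
Proof. by rewrite det3_swap det3Zr -mulrN -det3_swap. Qed.

Lemma det3_eqr u v : det3 u v v = 0.
Proof. by rewrite /det3 /dot !crossE; ring. Qed.

Lemma det3_eql u v : det3 u u v = 0.
Proof. by rewrite /det3 /dot !crossE; ring. Qed.

Lemma det3_addm c u v w : det3 u (c *: u + v) w = det3 u v w.
Proof. by rewrite /det3 /dot !mxE /=; ring. Qed.

(** Cramer's rule without division, over any commutative ring. *)
Lemma cramer3 u v w x :
  det3 u v w *: x = det3 x v w *: u + det3 u x w *: v + det3 u v x *: w.
Proof. by apply: row3P; rewrite /det3 /dot !mxE /= ; ring. Qed.

(** The projection of the space onto the line of [cross u v], along the plane
    [w], is the identity modulo the forms [u] and [v]. *)
Lemma cross_proj u v w x i :
  dot (cross u v) w * x 0 i - dot w x * cross u v 0 i =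
  - cross w v 0 i * dot u x + cross w u 0 i * dot v x.
Proof. by move: i; apply: ord3_ind; rewrite /dot !crossE; ring. Qed.

Lemma crossA u v w : cross u (cross v w) = dot u w *: v - dot u v *: w.
Proof. by apply: row3P; rewrite !crossE !mxE /dot /=; ring. Qed.

Lemma crossZr u c v : cross u (c *: v) = c *: cross u v.
Proof. by apply: row3P; rewrite !mxE /=; ring. Qed.

Lemma crossZl c u v : cross (c *: u) v = c *: cross u v.
Proof. by apply: row3P; rewrite !mxE /=; ring. Qed.

Lemma crossNC u v : cross u v = - cross v u.
Proof. by apply: row3P; rewrite !mxE /=; ring. Qed.

Lemma cross0r u : cross u 0 = 0.
Proof. by apply: row3P; rewrite !mxE /=; ring. Qed.

Lemma dot0r u : dot u 0 = 0.
Proof. by rewrite /dot !mxE; ring. Qed.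
End Triples.

Lemma dot_map (A B : comNzRingType) (f : {rmorphism A -> B}) u v :
  dot (map_mx f u) (map_mx f v) = f (dot u v).
Proof. by rewrite /dot !mxE !rmorphD !rmorphM. Qed.

Lemma cross_map (A B : comNzRingType) (f : {rmorphism A -> B}) u v :
  cross (map_mx f u) (map_mx f v) = map_mx f (cross u v).
Proof. by apply: row3P; rewrite !mxE /= rmorphB !rmorphM. Qed.

Lemma det3_map (A B : comNzRingType) (f : {rmorphism A -> B}) u v w :
  det3 (map_mx f u) (map_mx f v) (map_mx f w) = f (det3 u v w).
Proof. by rewrite /det3 cross_map dot_map. Qed.

Lemma rmorph_comb0 (A B : comNzRingType) (f : {rmorphism A -> B}) x y u v :
  f u = 0 -> f v = 0 -> f (x * u + y * v) = 0.
Proof. by move=> fu fv; rewrite rmorphD !rmorphM fu fv !mulr0 addr0. Qed.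

Section TriplesDomain.
Variable A : idomainType.
Implicit Types a b u v w x y z : 'rV[A]_3.

(** The vector [det3 x y z *: a] is a combination of the three products of [a]
    with [x], [y] and [z]. *)
Lemma det3_perp a x y z : a != 0 ->
  dot a x = 0 -> dot a y = 0 -> dot a z = 0 -> det3 x y z = 0.
Proof.
move=> a0 ax ay az; apply/eqP; apply: contraNT a0 => d0; apply/eqP.
have E : det3 x y z *: a = 0.
  have -> : det3 x y z *: a =
      dot a x *: cross y z + dot a y *: cross z x + dot a z *: cross x y.
    by apply: row3P; rewrite /det3 /dot !mxE /=; ring.
  by rewrite ax ay az !scale0r !addr0.
by move/eqP: E; rewrite scalemx_eq0 (negPf d0) => /eqP.
Qed.

Lemma row_neq0P u : u != 0 -> exists i, u 0 i != 0.
Proof.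
move=> u0; apply/existsP; apply: contraNT u0 => /existsPn h.
by apply/eqP/rowP => i; rewrite mxE; apply/eqP; have := h i; rewrite negbK.
Qed.

Lemma cross_eq0_scale x y i : cross x y = 0 -> y 0 i *: x = x 0 i *: y.
Proof.
move=> /rowP E; have := E o0; have := E o1; have := E o2.
rewrite !mxE /= => e2 e1 e0.
(* Each difference of components is zero, or a minor up to sign. *)
apply: row3P; rewrite !mxE; apply/eqP; rewrite -subr_eq0; apply/eqP;
  move: i; apply: ord3_ind;
  first [ring | by rewrite -[RHS]e0; ring | by rewrite -[RHS]e1; ring
  | by rewrite -[RHS]e2; ring | by rewrite -[RHS]oppr0 -[in RHS]e0; ring
  | by rewrite -[RHS]oppr0 -[in RHS]e1; ring
  | by rewrite -[RHS]oppr0 -[in RHS]e2; ring].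
Qed.

Lemma cross_trans u x y : u != 0 -> cross u x = 0 -> cross u y = 0 ->
  cross x y = 0.
Proof.
move=> /row_neq0P [i ui] ux uy; apply/eqP.
have : cross (u 0 i *: x) (u 0 i *: y) = 0.
  rewrite -(cross_eq0_scale i ux) -(cross_eq0_scale i uy).
  by apply: row3P; rewrite !mxE /=; ring.
by rewrite crossZr crossZl scalerA => /eqP; rewrite scalemx_eq0 mulf_eq0 (negPf ui).
Qed.

(** Both vectors are proportional to [cross a b]. *)
Lemma cross_perp a b x y : cross a b != 0 ->
  dot a x = 0 -> dot b x = 0 -> dot a y = 0 -> dot b y = 0 -> cross x y = 0.
Proof.
move=> ab ax bx ay by_.
have Px : cross (cross a b) x = 0.
  by rewrite crossNC crossA dotC bx dotC ax !scale0r subr0 oppr0.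
have Py : cross (cross a b) y = 0.
  by rewrite crossNC crossA dotC by_ dotC ay !scale0r subr0 oppr0.
exact: (cross_trans ab).
Qed.

(** In the plane [a], the vector [cross x y] is a multiple of [a], and [w] reads
    off the factor. *)
Lemma cross_perp_det a x w y :
  dot a w != 0 -> dot a x = 0 -> dot a y = 0 -> det3 x w y = 0 -> cross x y = 0.
Proof.
move=> aw ax ay d.
have : dot a w *: cross x y = 0.
  have -> : dot a w *: cross x y =
      dot a x *: cross w y + dot a y *: cross x w - det3 x w y *: a.
    by apply: row3P; rewrite /det3 /dot !mxE /=; ring.
  by rewrite ax ay d !scale0r subr0 addr0.
by move/eqP; rewrite scalemx_eq0 (negPf aw) => /eqP.
Qed.

Lemma det3_perp2 a b x w y : cross a b != 0 ->
  dot a x = 0 -> dot b x = 0 -> dot a y = 0 -> dot b y = 0 -> det3 x w y = 0.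
Proof.
move=> ab ax bx ay by_; rewrite det3_swap det3_dotr (cross_perp ab ax bx ay by_).
by rewrite dotC dot0r oppr0.
Qed.

(** By Cramer's rule [det3 e x y *: v] is a multiple of [e]; as [a] kills [v]
    but not [e], the multiple is zero. *)
Lemma det3_wedges a e v x y : dot a v = 0 -> dot a e != 0 -> v != 0 ->
  det3 e v x = 0 -> det3 e v y = 0 -> det3 e x y = 0.
Proof.
move=> av ae v0 dx dy; have := cramer3 e x y v.
rewrite dy [det3 e x v]det3_swap dx oppr0 !scale0r !addr0 => E.
have d0 : det3 v x y = 0.
  have := congr1 (dot a) E; rewrite !dotZr av mulr0 => /esym/eqP.
  by rewrite mulf_eq0 (negPf ae) orbF => /eqP.
by move/eqP: E; rewrite d0 scale0r scalemx_eq0 (negPf v0) orbF => /eqP.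
Qed.
End TriplesDomain.

Lemma dot_eq1 (K : fieldType) (a : 'rV[K]_3) : a != 0 -> exists u, dot a u = 1.
Proof.
move=> /row_neq0P [i ai].
exists ((a 0 i)^-1 *: delta_mx 0 i); rewrite dotZr.
suff -> : dot a (delta_mx 0 i) = a 0 i by rewrite mulVf.
by move: {ai}i; apply: ord3_ind; rewrite /dot !mxE /=; ring.
Qed.

Lemma dep3_comb (K : fieldType) (a b v : 'rV[K]_3) :
  cross a b != 0 -> det3 v a b = 0 -> exists x y, v = x *: a + y *: b.
Proof.
move=> ab d; have [u Pu] := dot_eq1 ab; pose w := cross v u.
exists (- dot w b), (dot w a).
have -> : v = dot (cross a b) u *: v - det3 v a b *: u.
  by rewrite Pu d scale0r subr0 scale1r.
by apply: row3P; rewrite /w /det3 /dot !mxE /=; ring.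
Qed.

Lemma cross_eq0_prop (K : fieldType) (v w : 'rV[K]_3) :
  v != 0 -> cross w v = 0 -> exists c, w = c *: v.
Proof.
move=> /row_neq0P [i vi] /(cross_eq0_scale i) E.
by exists (w 0 i / v 0 i); rewrite mulrC -scalerA -E scalerA mulVf // scale1r.
Qed.

(** * Divisibility by linear forms *)

Section LinearForms.
Variable K : fieldType.
Local Notation S := {mpoly K[3]}.
Implicit Types (a b v w : 'rV[K]_3) (f g F G : S).

Definition cst v : 'rV[S]_3 := map_mx (mpolyC 3 (R := K)) v.
Definition euler : 'rV[S]_3 := \row_i 'X_i.
Definition lin a : S := dot (cst a) euler.

Definition pdvd f F := exists g, F = g * f.
Definition ideal2 f g F := exists x y, F = x * f + y * g.

Lemma ideal2_0 f F : ideal2 f 0 F <-> pdvd f F.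
Proof.
split=> [[x [y ->]]|[x ->]]; first by exists x; rewrite mulr0 addr0.
by exists x, 0; rewrite mulr0 addr0.
Qed.

Lemma pdvd_ideal2l f g F : pdvd f F -> ideal2 f g F.
Proof. by case=> x ->; exists x, 0; rewrite mul0r addr0. Qed.

Lemma pdvd_ideal2r f g F : pdvd g F -> ideal2 f g F.
Proof. by case=> x ->; exists 0, x; rewrite mul0r add0r. Qed.

Lemma ideal2D f g F G : ideal2 f g F -> ideal2 f g G -> ideal2 f g (F + G).
Proof. by move=> [x [y ->]] [z [t ->]]; exists (x + z), (y + t); ring. Qed.

Lemma ideal2Ml f g F G : ideal2 f g F -> ideal2 f g (G * F).
Proof. by move=> [x [y ->]]; exists (G * x), (G * y); ring. Qed.

Lemma pdvdD f F G : pdvd f F -> pdvd f G -> pdvd f (F + G).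
Proof. by move=> [x ->] [y ->]; exists (x + y); ring. Qed.

Lemma pdvdMl f F G : pdvd f F -> pdvd f (G * F).
Proof. by move=> [x ->]; exists (G * x); ring. Qed.

Lemma pdvdMr f F G : pdvd f F -> pdvd f (F * G).
Proof. by move=> h; rewrite mulrC; apply: pdvdMl. Qed.

Lemma pdvdB f F G : pdvd f F -> pdvd f G -> pdvd f (F - G).
Proof. by move=> hF hG; apply: pdvdD => //; rewrite -mulN1r; apply: pdvdMl. Qed.

Lemma pdvd_refl f : pdvd f f.
Proof. by exists 1; rewrite mul1r. Qed.

Lemma pdvd0 f : pdvd f 0.
Proof. by exists 0; rewrite mul0r. Qed.

Lemma mpoly_alg_ind (P : S -> Prop) :
  (forall c : K, P c%:MP) -> (forall i, P 'X_i) ->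
  (forall F G, P F -> P G -> P (F + G)) ->
  (forall F G, P F -> P G -> P (F * G)) -> forall F, P F.
Proof.
move=> PC PX PD PM F; rewrite [F]mpolyE.
apply: big_ind => [||m _]; [by rewrite -mpolyC0| exact: PD|].
rewrite -mul_mpolyC; apply: (PM _ _ (PC _)); rewrite mpolyXE_id.
apply: big_ind => [||i _]; [by rewrite -mpolyC1| exact: PM|].
by elim: (m i) => [|k IH]; rewrite ?expr0 ?exprS -?mpolyC1 //; apply: PM.
Qed.

Section Substitution.
Variable y : 'rV[S]_3.

Definition subst (F : S) : S := F \mPo [tuple y 0 i | i < 3].

HB.instance Definition _ := GRing.RMorphism.copy subst
  (comp_mpoly [tuple y 0 i | i < 3]).

Lemma substC c : subst c%:MP = c%:MP.
Proof. exact: comp_mpolyC. Qed.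

Lemma substX i : subst 'X_i = y 0 i.
Proof. by rewrite /subst comp_mpolyXU -tnth_nth tnth_mktuple. Qed.

Lemma subst_cst v : map_mx subst (cst v) = cst v.
Proof. by apply/rowP => i; rewrite !mxE; exact: substC. Qed.

Lemma subst_euler : map_mx subst euler = y.
Proof. by apply/rowP => i; rewrite !mxE; exact: substX. Qed.

Lemma subst_lin a : subst (lin a) = dot (cst a) y.
Proof. by rewrite /lin -dot_map subst_cst subst_euler. Qed.

(** An endomorphism fixing the constants is determined by its values on the
    variables, also modulo an ideal. *)
Lemma subst_mod f g : (forall i, ideal2 f g ('X_i - y 0 i)) ->
  forall F, ideal2 f g (F - subst F).
Proof.
move=> H; apply: mpoly_alg_ind => [c|i|F G hF hG|F G hF hG].
- by rewrite substC subrr; apply/pdvd_ideal2l/pdvd0.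
- by rewrite substX; apply: H.
- have -> : F + G - subst (F + G) = (F - subst F) + (G - subst G).
    by rewrite rmorphD /=; ring.
  exact: ideal2D.
- have -> : F * G - subst (F * G) = F * (G - subst G) + subst G * (F - subst F).
    by rewrite rmorphM /=; ring.
  by apply: ideal2D; apply: ideal2Ml.
Qed.
End Substitution.

Lemma lin_eq0 a : (lin a == 0) = (a == 0).
Proof.
apply/idP/idP => [|/eqP ->]; last first.
  by rewrite /lin /dot !mxE !mpolyC0 !mul0r !addr0.
move=> /eqP E; apply/eqP/rowP => i; rewrite mxE.
have {E} := congr1 (mcoeff U_(i)) E.
rewrite /lin /dot !mxE !mcoeffD !mcoeffCM !mcoeffXU mcoeff0.
by move: i; apply: ord3_ind; rewrite /= !(mulr0, mulr1, addr0, add0r).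
Qed.

Lemma linZ c a : lin (c *: a) = c%:MP * lin a.
Proof. by rewrite /lin /dot !mxE !mpolyCM; ring. Qed.

Lemma linD a b : lin (a + b) = lin a + lin b.
Proof. by rewrite /lin /dot !mxE !mpolyCD; ring. Qed.

Lemma cstD v w : cst (v + w) = cst v + cst w.
Proof. by apply/rowP => i; rewrite !mxE mpolyCD. Qed.

Lemma cstZ c v : cst (c *: v) = c%:MP *: cst v.
Proof. by apply/rowP => i; rewrite !mxE mpolyCM. Qed.

Lemma dot_cst v w : dot (cst v) (cst w) = (dot v w)%:MP.
Proof. exact: dot_map. Qed.

Lemma cst_eq0 v : (cst v == 0) = (v == 0).
Proof. exact: map_mx_eq0. Qed.

Lemma cross_cst v w : cross (cst v) (cst w) = cst (cross v w).
Proof. exact: cross_map. Qed.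

(** The projection of the space onto the plane [a = 0] identifies the
    quotient by [lin a] with a subring. *)
Lemma quotient_lin a : a != 0 -> exists phi : {rmorphism S -> S},
  (forall v, map_mx phi (cst v) = cst v) /\
  (forall F, phi F = 0 <-> pdvd (lin a) F).
Proof.
move=> /dot_eq1 [u au]; pose y := euler - lin a *: cst u.
have phia : subst y (lin a) = 0.
  rewrite subst_lin /y dotDr dotNr dotZr dot_cst au mpolyC1 mulr1.
  by rewrite subrr.
exists (subst y); split=> [v|F]; first exact: subst_cst.
split=> [E|[g ->]]; last by rewrite rmorphM /= phia mulr0.
apply/ideal2_0; rewrite -[F]subr0 -E; apply: subst_mod => i.
apply/pdvd_ideal2l; exists (cst u 0 i); rewrite /y !mxE; ring.
Qed.

(** Here the projection is onto the line spanned by [cross a b], where the two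
    forms vanish; since it has values in a domain, the ideal is prime. *)
Lemma quotient_lin2 a b : cross a b != 0 -> exists phi : {rmorphism S -> S},
  (forall v, map_mx phi (cst v) = cst v) /\
  (forall F, phi F = 0 <-> ideal2 (lin a) (lin b) F).
Proof.
move=> ab; have [u Pu] := dot_eq1 ab; set P := cross a b in Pu.
pose y := lin u *: cst P.
have ya : subst y (lin a) = 0.
  rewrite subst_lin /y dotZr dot_cst; suff -> : dot a P = 0.
    by rewrite mpolyC0 mulr0.
  by rewrite /P /dot !crossE; ring.
have yb : subst y (lin b) = 0.
  rewrite subst_lin /y dotZr dot_cst; suff -> : dot b P = 0.
    by rewrite mpolyC0 mulr0.
  by rewrite /P /dot !crossE; ring.
exists (subst y); split=> [v|F]; first exact: subst_cst.
split=> [E|]; last first.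
  by case=> g [h ->]; apply: (@rmorph_comb0 _ _ (subst y)); [exact: ya|exact: yb].
rewrite -[F]subr0 -E; apply: subst_mod => i.
have := cross_proj (cst a) (cst b) (cst u) (euler) i.
rewrite cross_cst dot_cst Pu mpolyC1 mul1r [euler 0 i]mxE => Ei.
have -> : y 0 i = lin u * cst (cross a b) 0 i by rewrite /y mxE.
by rewrite Ei; do 2!eexists.
Qed.

Lemma lin_prime a F G : a != 0 ->
  pdvd (lin a) (F * G) -> pdvd (lin a) F \/ pdvd (lin a) G.
Proof.
move=> /quotient_lin [phi [_ H]] /H; rewrite rmorphM => /eqP.
by rewrite mulf_eq0 => /orP [] /eqP /H; [left|right].
Qed.

Lemma ideal2_prime a b F G : cross a b != 0 -> ideal2 (lin a) (lin b) (F * G) ->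
  ideal2 (lin a) (lin b) F \/ ideal2 (lin a) (lin b) G.
Proof.
move=> /quotient_lin2 [phi [_ H]] /H; rewrite rmorphM => /eqP.
by rewrite mulf_eq0 => /orP [] /eqP /H; [left|right].
Qed.

(** Evaluate at [cross a b], the common zero of the two forms. *)
Lemma ideal2_lin a b v : cross a b != 0 ->
  ideal2 (lin a) (lin b) (lin v) <-> det3 v a b = 0.
Proof.
move=> ab; split=> [[f [g E]]|d].
  have ev w : (lin w).@[fun i => cross a b 0 i] = det3 w a b.
    by rewrite /lin /dot !mxE !mevalD !mevalM !mevalC !mevalXU.
  rewrite -ev E; apply: (@rmorph_comb0 _ _ (meval (fun i => cross a b 0 i))).
    by apply: (etrans (ev a)); apply: det3_eql.
  by apply: (etrans (ev b)); rewrite det3_rot det3_eqr.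
have [x [y ->]] := dep3_comb ab d.
by rewrite linD !linZ; exists x%:MP, y%:MP.
Qed.

End LinearForms.

(** * Logarithmic derivations as triples of polynomials *)

Lemma pdvd_lin (K : fieldType) (b c : 'rV[K]_3) :
  cross c b != 0 -> ~ pdvd (lin c) (lin b).
Proof.
move=> cb; have [w dw] := dot_eq1 cb => H.
have db : det3 b c w = - 1.
  by rewrite det3_rot det3_swap det3_dotr dw.
have cw : cross c w != 0.
  by apply/eqP => cw0; move/eqP: db; rewrite /det3 cw0 dot0r eq_sym oppr_eq0 oner_eq0.
have /(ideal2_lin _ cw) : ideal2 (lin c) (lin w) (lin b) by exact: pdvd_ideal2l.
by rewrite db => /eqP; rewrite oppr_eq0 oner_eq0.
Qed.

Section Arrangement.
Variables (K : fieldType) (I : finType) (a : I -> 'rV[K]_3).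
Hypothesis a_neq0 : forall i, a i != 0.
Hypothesis a_indep : forall i j, i != j -> cross (a i) (a j) != 0.
Local Notation S := {mpoly K[3]}.
Implicit Types (i j h r : I) (J R : {set I}) (t : 'rV[S]_3) (F G : S).

Definition tangent J t :=
  forall i, i \in J -> pdvd (lin (a i)) (dot (cst (a i)) t).

(** Three lines are concurrent when their forms are dependent. *)
Definition conc i j k := det3 (a i) (a j) (a k) == 0.

Definition linprod J : S := \prod_(i in J) lin (a i).

Lemma linprod_neq0 J : linprod J != 0.
Proof. by apply/prodf_neq0 => i _; rewrite lin_eq0. Qed.

Lemma linprodU1 i J : i \notin J -> linprod (i |: J) = lin (a i) * linprod J.
Proof. by move=> iJ; rewrite /linprod big_setU1. Qed.

Lemma linprodD1 i J : i \in J -> linprod J = lin (a i) * linprod (J :\ i).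
Proof. by move=> iJ; rewrite /linprod (big_setD1 i). Qed.

Lemma linprodID J R : R \subset J -> linprod J = linprod R * linprod (J :\: R).
Proof.
by move=> /setIidPr RJ; rewrite /linprod (big_setID R) RJ.
Qed.

Lemma lin_ndvd_linprod i J : i \notin J -> ~ pdvd (lin (a i)) (linprod J).
Proof.
move=> iJ; have [phi [_ H]] := quotient_lin (a_neq0 i).
move=> /H /eqP; rewrite rmorph_prod; apply/negP/prodf_neq0 => j jJ.
apply/eqP => /H; apply: pdvd_lin; apply: a_indep.
by apply: contraNneq iJ => ->.
Qed.

Lemma set_ind1 (P : {set I} -> Prop) :
  P set0 -> (forall i J, i \notin J -> P J -> P (i |: J)) ->
  forall J, P J.
Proof.
move=> P0 PU J; have [n] := ubnP #|J|; elim: n J => // n IH J.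
have [->//|[i iJ]] := set_0Vmem J.
rewrite (cardsD1 i) iJ /= ltnS => lt; rewrite -(setD1K iJ).
by apply: PU; [rewrite setD11|apply: IH].
Qed.

Lemma linprod_dvd J F :
  (forall i, i \in J -> pdvd (lin (a i)) F) -> pdvd (linprod J) F.
Proof.
elim/set_ind1: J => [_|i J iJ IH HF].
  by exists F; rewrite /linprod big_set0 mulr1.
have [|G E] := IH; first by move=> j jJ; apply: HF; rewrite inE jJ orbT.
rewrite linprodU1 //; have := HF i (setU11 _ _); rewrite E.
by case/(lin_prime (a_neq0 i)) => [[x ->]|/(lin_ndvd_linprod iJ) //]; exists x; rewrite mulrA.
Qed.

(** In the quotient by [lin v], a domain, the forms of [J] are prime and none of
    them divides [G]. *)
Lemma ideal2_linprod v J G F :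
  v != 0 ->
  (forall i, i \in J ->
    cross v (a i) != 0 /\ ~ ideal2 (lin v) (lin (a i)) G) ->
  ideal2 (lin v) (linprod J) F -> ideal2 (lin v) G F ->
  ideal2 (lin v) (linprod J * G) F.
Proof.
move=> v0; have [phi [_ H]] := quotient_lin v0.
elim/set_ind1: J => [_ _|i J iJ IH HJ]; first by rewrite /linprod big_set0 mul1r.
have {}HJ j : j \in i |: J -> _ := HJ j.
have HJ' j : j \in J -> _ := fun jJ => HJ j (setU1r i jJ).
rewrite linprodU1 // => -[x' [y EF]] HG.
have [|x [g EF']] := IH HJ' _ HG; first by exists x', (y * lin (a i)); rewrite EF mulrA.
have phiv : phi (lin v) = 0 by apply/H/pdvd_refl.
have phiJ : phi (linprod J) != 0.
  rewrite rmorph_prod; apply/prodf_neq0 => j jJ; apply/eqP => /H.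
  by apply: pdvd_lin; case: (HJ' j jJ).
have /H [z Ez] : phi (g * G - y * lin (a i)) = 0.
  apply: (mulfI phiJ); rewrite mulr0 -rmorphM /=.
  have -> : linprod J * (g * G - y * lin (a i)) = (x' - x) * lin v.
    have := EF'; rewrite {1}EF.
    move: (linprod J) (lin v) (lin (a i)) => P l l' E.
    have -> : P * (g * G - y * l') = (x * l + g * (P * G)) - x * l - y * (l' * P).
      by ring.
    by rewrite -E; ring.
  by rewrite rmorphM /= phiv mulr0.
have [vi nG] := HJ i (setU11 _ _).
have : ideal2 (lin v) (lin (a i)) (g * G).
  by exists z, y; rewrite -Ez; ring.
case/(ideal2_prime vi) => // -[u [w Eg]].
exists (x + u * (linprod J * G)), w; rewrite EF' Eg.
move: (linprod J) (lin v) (lin (a i)) => P l l'; clear; ring.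
Qed.

Lemma conc_sym i j k : conc i j k = conc j k i.
Proof. by rewrite /conc det3_rot. Qed.

Lemma conc_swap i j k : conc i j k = conc i k j.
Proof. by rewrite /conc det3_swap oppr_eq0. Qed.

Lemma conc_eqr i j : conc i j j.
Proof. by rewrite /conc det3_eqr. Qed.

(** Two distinct lines have only one point in common. *)
Lemma conc_trans i j r s : i != j -> conc i j r -> conc i j s -> conc i r s.
Proof.
move=> /a_indep ij /eqP cr /eqP cs; apply/eqP.
apply: (det3_perp ij); first by rewrite -det3_dotr det3_rot det3_eqr.
  by rewrite -det3_dotr.
by rewrite -det3_dotr.
Qed.

Lemma ideal2_conc i j k : i != j ->
  ideal2 (lin (a i)) (lin (a j)) (lin (a k)) <-> conc i j k.
Proof.
move=> /a_indep ij; rewrite (ideal2_lin _ ij) det3_rot.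
by split=> /eqP.
Qed.

Lemma ideal2_linprodP i j J : i != j ->
  ideal2 (lin (a i)) (lin (a j)) (linprod J) -> exists2 k, k \in J & conc i j k.
Proof.
move=> ij; have [phi [_ H]] := quotient_lin2 (a_indep ij).
move=> /H /eqP; rewrite rmorph_prod prodf_seq_eq0 => /hasP [k _].
by case/andP=> kJ /eqP /H /(ideal2_conc _ ij); exists k.
Qed.

(** [R] selects one line of [J] through each point where [J] meets the line
    [h]; thus [#|R|] is the number of these points. *)
Definition transversal h J R :=
  [/\ R \subset J, h \notin J,
      forall i, i \in J :\: R -> exists2 r, r \in R & conc h r i
    & forall r s, r \in R -> s \in R -> r != s -> ~~ conc h r s].

Section AtAPoint.
Variables (h r : I) (J : {set I}) (t : 'rV[S]_3).
Hypotheses (hr : h != r) (rJ : r \notin J) (hJ : h \notin J).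
Hypothesis concJ : forall i, i \in J -> conc h r i.

(** With [t(r) = g r], the polynomial [t(h) - g h] is divisible by every linear
    combination [i] of [h] and [r] for which [t(i)] is divisible by [i]. *)
Lemma restrict_at_point : tangent (r |: J) t ->
  ideal2 (lin (a h)) (linprod J) (dot (cst (a h)) t).
Proof.
move=> tJ; have [g Eg] := tJ r (setU11 _ _).
have [q Eq] : pdvd (linprod J) (dot (cst (a h)) t - g * lin (a h)).
  apply: linprod_dvd => i iJ; have /eqP := concJ iJ; rewrite -det3_rot => d.
  have [x [y Ei]] := dep3_comb (a_indep hr) d.
  have x0 : x != 0.
    apply/eqP => x0; have : i != r by apply: contraNneq rJ => <-.
    move/a_indep/eqP; apply; rewrite Ei x0 scale0r add0r crossZl.
    by rewrite -[a r](scale1r) crossZr; apply: row3P; rewrite !mxE /=; ring.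
  have [k Ek] := tJ i (setU1r _ iJ).
  exists ((x^-1)%:MP * (k - g)).
  have Et : k * lin (a i) = x%:MP * dot (cst (a h)) t + y%:MP * (g * lin (a r)).
    by rewrite -Ek -Eg Ei cstD !cstZ dotC dotDr !dotZr !(dotC t).
  have El : lin (a i) = x%:MP * lin (a h) + y%:MP * lin (a r).
    by rewrite Ei linD !linZ.
  have E : (k - g) * lin (a i) = x%:MP * (dot (cst (a h)) t - g * lin (a h)).
    rewrite mulrBl Et {1}El.
    move: (lin (a h)) (lin (a r)) (dot _ _) => l l' T; clear; ring.
  by rewrite -mulrA E mulrA -mpolyCM mulVf // mpolyC1 mul1r.
by exists g, q; rewrite -Eq addrC subrK.
Qed.
End AtAPoint.

(** The product of the lines outside [R] is Terao's polynomial of [h]. The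
    divisibilities at the single points of [h] combine, because lines which meet
    [h] in distinct points have coprime forms modulo [lin (a h)]. *)
Lemma terao_restriction h J R t : transversal h J R -> tangent J t ->
  ideal2 (lin (a h)) (linprod (J :\: R)) (dot (cst (a h)) t).
Proof.
move=> [RJ hJ cov sep] tJ.
pose U (rs : seq I) := [set i in J :\: R | has (fun r => conc h r i) rs].
have hneq i : i \in J -> h != i by move=> iJ; apply: contraNneq hJ => ->.
(* Induction on the points of [h], represented by the lines of [R]. *)
suff : forall rs, {subset rs <= R} -> uniq rs ->
    ideal2 (lin (a h)) (linprod (U rs)) (dot (cst (a h)) t).
  move/(_ (enum R)); rewrite (_ : U (enum R) = J :\: R).
    by apply; [move=> r; rewrite mem_enum|exact: enum_uniq].
  apply/setP => i; rewrite inE; apply: andb_idr => /cov [r rR hri].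
  by apply/hasP; exists r; rewrite ?mem_enum.
elim=> [|r rs IH] sub.
  rewrite (_ : U [::] = set0); last by apply/setP => i; rewrite !inE andbF.
  by move=> _; apply: pdvd_ideal2r; exists (dot (cst (a h)) t); rewrite /linprod big_set0 mulr1.
move=> /= /andP [rrs urs].
have rR : r \in R by apply: sub; rewrite inE eqxx.
have sub' : {subset rs <= R} by move=> s srs; apply: sub; rewrite inE srs orbT.
have hr : h != r by apply: hneq; exact: (subsetP RJ).
pose C := [set i in J :\: R | conc h r i].
have excl i j : i \in C -> j \in U rs -> ~~ conc h i j.
  rewrite !inE => /andP [/andP [_ iJ] hri] /andP [/andP [_ jJ] /hasP [s srs hsj]].
  apply/negP => hij.
  have rs0 : r != s by apply: contraNneq rrs => ->.
  have := sep _ _ rR (sub' _ srs) rs0; case/negP.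
  have hir : conc h i r by rewrite conc_swap.
  have hjs : conc h j s by rewrite conc_swap.
  apply: (conc_trans (hneq _ jJ)) => //.
  have := conc_trans (hneq _ iJ) hij hir.
  by [].
have -> : linprod (U (r :: rs)) = linprod C * linprod (U rs).
  have -> : U (r :: rs) = C :|: U rs.
    by apply/setP => i; rewrite !inE /= -andb_orr.
  rewrite (linprodID (subsetUl C _)); congr (_ * linprod _).
  apply/setP => i; rewrite !(in_setD, in_setU).
  case: (boolP (i \in C)) => //= iC; apply/esym/negP => iU.
  by have := excl i i iC iU; rewrite conc_eqr.
apply: ideal2_linprod => //; last exact: IH.
  move=> i iC; have iJ : i \in J by move: iC; rewrite !inE => /andP [/andP []].
  split; first exact/a_indep/hneq.
  by move/(ideal2_linprodP (hneq _ iJ)) => [j jU]; apply/negP/excl.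
apply: (@restrict_at_point h r) => //.
- by rewrite !inE rR.
- by move=> i; rewrite /C in_set => /andP [].
- move=> i /setU1P [->|]; first by apply/tJ/(subsetP RJ).
  by rewrite /C in_set => /andP [/setDP [iJ _] _]; apply: tJ.
Qed.
End Arrangement.

(** * Homogeneous components *)

Section Homogeneous.
Variable K : fieldType.
Local Notation S := {mpoly K[3]}.
Implicit Types (v w : 'rV[K]_3) (t : 'rV[S]_3) (F G : S) (d e : nat).

Definition hpart d (F : S) : S := pihomog mdeg d F.
HB.instance Definition _ d :=
  GRing.Linear.copy (hpart d) (pihomog (n := 3) (R := K) mdeg d).

Definition homrow d t := forall i, t 0 i \is d.-homog.

Lemma hpart_homog d F : hpart d F \is d.-homog.
Proof. exact: pihomogP. Qed.

Lemma homog_hpart d F : F \is d.-homog -> hpart d F = F.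
Proof. exact: pihomog_dE. Qed.

Lemma homog_hpart0 d e F : F \is d.-homog -> d != e -> hpart e F = 0.
Proof. by move=> hF ne; apply: pihomog_ne0 hF. Qed.

Lemma hpartX d m : hpart d 'X_[m] = if mdeg m == d then 'X_[m] else 0.
Proof. exact: pihomogX. Qed.

Lemma hpartM_homog d e F G : G \is e.-homog ->
  hpart d (F * G) = if (e <= d)%N then hpart (d - e) F * G else 0.
Proof.
move=> hG; elim/mpolyind: F => [|c m F _ _ IH].
  by rewrite mul0r !linear0 mul0r if_same.
have hXG : 'X_[m] * G \is (mdeg m + e).-homog by apply: dhomogM; rewrite ?dhomogX.
rewrite mulrDl linearD /= IH -scalerAl linearZ /=.
rewrite linearD linearZ /= hpartX.
have [Ed|nd] := eqVneq (mdeg m + e)%N d.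
  rewrite homog_hpart -?Ed //; rewrite leq_addl addnK eqxx mulrDl.
  by rewrite scalerAl.
rewrite (homog_hpart0 hXG) // scaler0 add0r; case: leqP => // ed.
by rewrite ifF ?scaler0 ?add0r //; apply/negbTE; apply: contra nd => /eqP ->; rewrite subnK.
Qed.

Lemma homogC (c : K) : (c%:MP : S) \is 0.-homog.
Proof. by rewrite -[c%:MP]mulr1 mul_mpolyC; apply: dhomogZ; apply: dhomog1. Qed.

Lemma homog0C F : F \is 0.-homog -> F = (F@_0)%:MP.
Proof.
move/dhomogP => h; apply: msize1_polyC; rewrite msizeE.
by apply/bigmax_leqP_seq => m mF _; rewrite h.
Qed.

Lemma homog_euler : homrow 1 (euler K).
Proof. by move=> i; rewrite mxE dhomogX /= mdeg1. Qed.

Lemma homog_cst v : homrow 0 (cst v).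
Proof. by move=> i; rewrite mxE; apply: homogC. Qed.

Lemma homogM d e F G : F \is d.-homog -> G \is e.-homog ->
  F * G \is (d + e).-homog.
Proof. exact: dhomogM. Qed.

Lemma homogD d F G : F \is d.-homog -> G \is d.-homog -> F + G \is d.-homog.
Proof. exact: rpredD. Qed.

Lemma homog_dot d e t t' : homrow d t -> homrow e t' ->
  dot t t' \is (d + e).-homog.
Proof. by move=> ht ht'; rewrite /dot; do 2?apply: homogD; apply: homogM. Qed.

Lemma homog_cross d e t t' : homrow d t -> homrow e t' ->
  homrow (d + e) (cross t t').
Proof.
move=> ht ht'; apply: ord3_ind; rewrite !mxE /=;
by apply: homogD; rewrite ?rpredN; apply: homogM.
Qed.

Lemma homog_det3 d e f t t' t'' : homrow d t -> homrow e t' -> homrow f t'' ->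
  det3 t t' t'' \is (d + (e + f)).-homog.
Proof. by move=> *; apply/homog_dot => //; apply: homog_cross. Qed.

Lemma homog_lin v : lin v \is 1.-homog.
Proof. exact: (homog_dot (homog_cst v) homog_euler). Qed.

Lemma homog1_lin F : F \is 1.-homog -> exists v, F = lin v.
Proof.
move=> hF; exists (\row_i F@_U_(i)); apply/mpolyP => m.
have [md|md] := eqVneq (mdeg m) 1%N; last first.
  by rewrite (dhomog_nemf_coeff hF md) (dhomog_nemf_coeff (homog_lin _) md).
have /mdeg1P [i /eqP ->] : mdeg m == 1%N by apply/eqP.
rewrite /lin /dot !mxE !mcoeffD !mcoeffCM !mcoeffXU.
by move: i; apply: ord3_ind; rewrite /= !(mulr0, mulr1, addr0, add0r).
Qed.

Lemma homog_pdvd d e F G : F \is (d + e).-homog -> G \is e.-homog -> pdvd G F ->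
  exists2 q, q \is d.-homog & F = q * G.
Proof.
move=> hF hG [q E]; exists (hpart d q); first exact: hpart_homog.
by rewrite -(homog_hpart hF) E (hpartM_homog _ _ hG) leq_addl addnK.
Qed.

Lemma homog_pdvd_lt d e F G : F \is d.-homog -> G \is e.-homog -> pdvd G F ->
  (d < e)%N -> F = 0.
Proof.
move=> hF hG [q E] lt.
by rewrite -(homog_hpart hF) E (hpartM_homog _ _ hG) (leqNgt e) lt.
Qed.

(** By degree, the multiple of [G] congruent to [F] modulo the plane is a
    constant multiple, zero when the degree of [F] is less. *)
Lemma ideal2_homog v d e F G : F \is d.-homog -> G \is e.-homog -> (d <= e)%N ->
  ideal2 (lin v) G F -> exists c, pdvd (lin v) (F - c%:MP * G).
Proof.
move=> hF hG de [x [y E]].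
have {}E := congr1 (hpart d) E; rewrite linearD /= (homog_hpart hF) in E.
rewrite (hpartM_homog _ _ (homog_lin v)) (hpartM_homog _ _ hG) in E.
have Ex : pdvd (lin v) (if (0 < d)%N then hpart (d - 1) x * lin v else 0).
  by case: ifP => _; [apply/pdvdMl/pdvd_refl|apply: pdvd0].
have [ed|ed] := leqP e d; last first.
  by exists 0; rewrite mpolyC0 mul0r subr0 E (leqNgt e) ed addr0.
rewrite ed in E.
have de0 : (d - e = 0)%N by apply/eqP; rewrite subn_eq0.
rewrite de0 in E; exists ((hpart 0 y)@_0).
by rewrite -(homog0C (hpart_homog 0 y)) E addrK.
Qed.

Lemma hpart_dot_cst d v t : dot (cst v) (map_mx (hpart d) t) = hpart d (dot (cst v) t).
Proof. by rewrite /dot !mxE !mul_mpolyC !linearD !linearZ. Qed.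

Lemma row_hpart_sum t : exists N, t = \sum_(d < N) map_mx (hpart d) t.
Proof.
exists (msize (t 0%R o0) + msize (t 0%R o1) + msize (t 0%R o2))%N.
by apply: row3P; rewrite summxE; under eq_bigr do rewrite mxE;
  apply: pihomog_partitionE; lia.
Qed.
End Homogeneous.

Section SaitoBases.
Variables (K : fieldType) (I : finType) (a : I -> 'rV[K]_3).
Hypothesis a_neq0 : forall i, a i != 0.
Hypothesis a_indep : forall i j, i != j -> cross (a i) (a j) != 0.
Local Notation S := {mpoly K[3]}.
Local Notation tangent := (tangent a).
Local Notation linprod := (linprod a).
Local Notation transversal := (transversal a).
Implicit Types (i j h r : I) (J R : {set I}) (t s : 'rV[S]_3) (F G : S).

Lemma homog_linprod J : linprod J \is #|J|.-homog.
Proof.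
elim/set_ind1: J => [|i J iJ IH]; first by rewrite /linprod big_set0 cards0 dhomog1.
by rewrite linprodU1 // cardsU1 iJ; apply: homogM => //; apply: homog_lin.
Qed.

Lemma tangent_euler J : tangent J (euler K).
Proof. by move=> i _; apply: pdvd_refl. Qed.

Lemma tangentD J t s : tangent J t -> tangent J s -> tangent J (t + s).
Proof. by move=> ht hs i iJ; rewrite dotDr; apply: pdvdD; [apply: ht|apply: hs]. Qed.

Lemma tangentZ J F t : tangent J t -> tangent J (F *: t).
Proof. by move=> ht i iJ; rewrite dotZr; apply/pdvdMl/ht. Qed.

Lemma tangent_hpart J d t : tangent J t -> tangent J (map_mx (hpart d) t).
Proof.
move=> ht i iJ; have [g E] := ht i iJ.
rewrite hpart_dot_cst E (hpartM_homog _ _ (homog_lin _)).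
by case: ifP => _; [apply/pdvdMl/pdvd_refl|apply: pdvd0].
Qed.

Lemma tangentU1 h J t : tangent J t -> pdvd (lin (a h)) (dot (cst (a h)) t) ->
  tangent (h |: J) t.
Proof. by move=> ht hh i /setU1P [->|/ht]. Qed.

Lemma tangent_sub J R t : R \subset J -> tangent J t -> tangent R t.
Proof. by move=> /subsetP sub ht i /sub /ht. Qed.

Lemma det3_pdvd (v : 'rV[K]_3) (x y z : 'rV[S]_3) : v != 0 ->
  pdvd (lin v) (dot (cst v) x) -> pdvd (lin v) (dot (cst v) y) ->
  pdvd (lin v) (dot (cst v) z) -> pdvd (lin v) (det3 x y z).
Proof.
move=> v0; have [phi [phic H]] := quotient_lin v0.
move=> /H hx /H hy /H hz; apply/H; rewrite -det3_map.
have v0' : map_mx phi (cst v) != 0 by rewrite phic cst_eq0.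
by apply: (det3_perp v0'); rewrite dot_map.
Qed.

(** At the point where [v] and [w] vanish, both [x] and [y] are proportional to
    this point. *)
Lemma det3_ideal2 (v w u : 'rV[K]_3) (x y : 'rV[S]_3) : cross v w != 0 ->
  ideal2 (lin v) (lin w) (dot (cst v) x) ->
  ideal2 (lin v) (lin w) (dot (cst w) x) ->
  ideal2 (lin v) (lin w) (dot (cst v) y) ->
  ideal2 (lin v) (lin w) (dot (cst w) y) ->
  ideal2 (lin v) (lin w) (det3 x (cst u) y).
Proof.
move=> vw; have [phi [phic H]] := quotient_lin2 vw.
move=> /H vx /H wx /H vy /H wy; apply/H; rewrite -det3_map.
have vw' : cross (map_mx phi (cst v)) (map_mx phi (cst w)) != 0.
  by rewrite !phic cross_cst cst_eq0.
by apply: (det3_perp2 _ vw'); rewrite dot_map.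
Qed.

(** Saito's criterion for a basis, one member of which is the Euler
    derivation. *)
Definition saito J := exists t1 t2 (c : K),
  [/\ c != 0, tangent J t1, tangent J t2 &
      det3 (euler K) t1 t2 = c%:MP * linprod J].

Lemma det3_linprod J t1 t2 t3 : tangent J t1 -> tangent J t2 -> tangent J t3 ->
  pdvd (linprod J) (det3 t1 t2 t3).
Proof.
move=> h1 h2 h3; apply: (linprod_dvd a_neq0 a_indep) => i iJ.
by apply: det3_pdvd => //; [apply: h1|apply: h2|apply: h3].
Qed.

(** The terms of the expansion of the determinant into homogeneous parts are
    determinants of logarithmic derivations; one of them has the degree of
    [linprod J] and does not vanish. *)
Lemma saito_homog J t1 t2 q : tangent J t1 -> tangent J t2 ->
  det3 (euler K) t1 t2 = q * linprod J -> q@_0%MM != 0 ->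
  exists s1 s2 (c : K) d1 d2,
  [/\ [/\ c != 0, tangent J s1, tangent J s2 &
      det3 (euler K) s1 s2 = c%:MP * linprod J],
      homrow d1 s1, homrow d2 s2, (d1 <= d2)%N & (d1 + d2).+1 = #|J|].
Proof.
move=> h1 h2 E q0.
suff : exists s1 s2 (c : K) d1 d2,
  [/\ [/\ c != 0, tangent J s1, tangent J s2 &
      det3 (euler K) s1 s2 = c%:MP * linprod J],
      homrow d1 s1, homrow d2 s2 & (d1 + d2).+1 = #|J|].
  move=> [s1 [s2 [c [d1 [d2 [[c0 hs1 hs2 Es] hd1 hd2 dd]]]]]].
  have [le|/ltnW le] := leqP d1 d2; first by exists s1, s2, c, d1, d2.
  exists s2, s1, (- c), d2, d1; split=> //; last by rewrite addnC.
  by split=> //; rewrite ?oppr_eq0 // det3_swap Es mpolyCN mulNr.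
have [N1 E1] := row_hpart_sum t1; have [N2 E2] := row_hpart_sum t2.
have Edet : det3 (euler K) t1 t2 = \sum_(d < N1) \sum_(e < N2)
    det3 (euler K) (map_mx (hpart d) t1) (map_mx (hpart e) t2).
  rewrite {1}E2 (big_morph (det3 _ _) (det3Dr _ _) (_ : det3 _ _ 0 = 0)); last first.
    by rewrite det3_dotr dot0r.
  rewrite exchange_big /=; apply: eq_bigr => e _.
  rewrite {1}E1 det3_swap (big_morph (det3 _ _) (det3Dr _ _) (_ : det3 _ _ 0 = 0)); last first.
    by rewrite det3_dotr dot0r.
  by rewrite -sumrN; apply: eq_bigr => d _; rewrite -det3_swap.
have hq : hpart #|J| (det3 (euler K) t1 t2) = (q@_0%MM)%:MP * linprod J.
  rewrite E (hpartM_homog _ _ (homog_linprod J)) leqnn subnn; congr (_ * _).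
  rewrite (homog0C (hpart_homog 0 q)); congr (_%:MP).
  have [N Eq] : exists N, q = \sum_(d < N.+1) hpart d q.
    by exists (msize q); apply: pihomog_partitionE; lia.
  rewrite [in RHS]Eq big_ord_recl mcoeffD [X in _ + X](_ : _ = 0) ?addr0 //.
  rewrite (raddf_sum (mcoeff 0%MM)); apply: big1 => d _ /=.
  by rewrite (dhomog_nemf_coeff (hpart_homog _ _)) //= mdeg0.
have [d [e nz]] : exists d e,
    hpart #|J| (det3 (euler K) (map_mx (hpart d) t1) (map_mx (hpart e) t2)) != 0.
  apply: contrapT => H; have : hpart #|J| (det3 (euler K) t1 t2) != 0.
    by rewrite hq mulf_neq0 ?mpolyC_eq0 ?linprod_neq0.
  case/negP; apply/eqP; rewrite Edet raddf_sum; apply: big1 => d _.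
  rewrite raddf_sum; apply: big1 => e _; apply: contrapT => nz.
  by apply: H; exists d, e; apply/eqP.
have hd : homrow d (map_mx (hpart d) t1) by move=> i; rewrite mxE; apply: hpart_homog.
have he : homrow e (map_mx (hpart e) t2) by move=> i; rewrite mxE; apply: hpart_homog.
have hdet := homog_det3 (homog_euler K) hd he.
have Ede : (1 + (d + e))%N = #|J|.
  by apply/eqP; apply: contraNT nz => ne; rewrite (homog_hpart0 hdet).
have := det3_linprod (@tangent_euler J) (@tangent_hpart J d _ h1) (@tangent_hpart J e _ h2).
rewrite Ede in hdet; rewrite (homog_hpart hdet) in nz.
case/(@homog_pdvd _ 0 _ _ _ hdet (homog_linprod J)) => x /homog0C Ex Edx.
exists (map_mx (hpart d) t1), (map_mx (hpart e) t2), (x@_0%MM), d, e.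
split=> //; split; try exact: tangent_hpart; last by rewrite -Ex.
by apply: contraNneq nz => x0; rewrite Edx Ex x0 mpolyC0 mul0r.
Qed.
End SaitoBases.

(** * Adding and deleting a line *)

Section AdditionDeletion.
Variables (K : fieldType) (I : finType) (a : I -> 'rV[K]_3).
Hypothesis a_neq0 : forall i, a i != 0.
Hypothesis a_indep : forall i j, i != j -> cross (a i) (a j) != 0.
Local Notation S := {mpoly K[3]}.
Local Notation tangent := (tangent a).
Local Notation linprod := (linprod a).
Local Notation transversal := (transversal a).
Local Notation saito := (saito a).
Local Notation conc := (conc a).
Implicit Types (i j h r : I) (J R : {set I}) (t s : 'rV[S]_3) (F G : S).

Lemma saito_homogW J : saito J -> exists s1 s2 (c : K) d1 d2,
  [/\ [/\ c != 0, tangent J s1, tangent J s2 &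
      det3 (euler K) s1 s2 = c%:MP * linprod J],
      homrow d1 s1, homrow d2 s2, (d1 <= d2)%N & (d1 + d2).+1 = #|J|].
Proof.
move=> [t1 [t2 [c [c0 h1 h2 E]]]].
by apply: (saito_homog a_neq0 a_indep h1 h2 E); rewrite mcoeffC eqxx mulr1.
Qed.

Lemma tangentB J t s : tangent J t -> tangent J s -> tangent J (t - s).
Proof.
by move=> ht hs; apply: tangentD => //; rewrite -scaleN1r; apply: tangentZ.
Qed.

(** One column operation makes the value of [kappa] on some member of a basis
    vanish on the plane: the value on the member of smallest degree is a
    constant multiple of [G] modulo the plane, all values are multiples. *)
Lemma saito_reduce J (v : 'rV[K]_3) (kappa : 'rV[S]_3 -> S) G d1 d2 (c : K) t1 t2 :
  (forall F t s, kappa (t - F *: s) = kappa t - F * kappa s) ->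
  (forall t, tangent J t -> ideal2 (lin v) G (kappa t)) ->
  (kappa t1 \is d1.-homog) -> G \is d2.-homog -> (d1 <= d2)%N ->
  c != 0 -> tangent J t1 -> tangent J t2 ->
  det3 (euler K) t1 t2 = c%:MP * linprod J ->
  exists s1 s2 (c' : K),
    [/\ c' != 0, tangent J s1, tangent J s2,
        det3 (euler K) s1 s2 = c'%:MP * linprod J & pdvd (lin v) (kappa s1)].
Proof.
move=> klin hk hk1 hG d12 c0 h1 h2 E.
have [b hb] := ideal2_homog hk1 hG d12 (hk _ h1).
have [b0|b0] := eqVneq b 0.
  exists t1, t2, c; split=> //.
  by move: hb; rewrite b0 mpolyC0 mul0r subr0.
have [x [y E2]] := hk _ h2.
pose g := y * (b^-1)%:MP.
exists (t2 - g *: t1), t1, (- c); split.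
- by rewrite oppr_eq0.
- exact/tangentB/tangentZ.
- exact: h1.
- rewrite det3_swap det3Dr det3Nr det3Zr det3_eqr mulr0 subr0 E.
  by rewrite mpolyCN mulNr.
rewrite klin {1}E2.
have -> : x * lin v + y * G - g * kappa t1 =
    x * lin v - g * (kappa t1 - b%:MP * G).
  have -> : y * G = g * (b%:MP * G).
    by rewrite /g !mulrA -[y * _ * _]mulrA -mpolyCM mulVf // mpolyC1 mulr1.
  by rewrite mulrBr opprB addrA.
by apply: pdvdB; apply: pdvdMl => //; apply: pdvd_refl.
Qed.

Lemma card_transversal h J R : transversal h J R -> #|J| = (#|R| + #|J :\: R|)%N.
Proof. by case=> RJ _ _ _; rewrite -(cardsID R J); move/setIidPr: RJ => ->. Qed.

(** Addition. The value of a logarithmic derivation on the new form restricts to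
    the new line as a multiple of a form of degree [#|J| - #|R|], by
    [terao_restriction]; the smaller of the degrees of a basis, at most half of
    [#|J| - 1], does not exceed this degree. *)
Lemma saito_add h J R : transversal h J R -> (2 * #|R| <= #|J| + 2)%N ->
  saito J -> saito (h |: J).
Proof.
move=> tr cR /saito_homogW [t1 [t2 [c [d1 [d2 [[c0 h1 h2 E] hd1 hd2 d12 dJ]]]]]].
have cJ := card_transversal tr; have [_ hJ _ _] := tr.
have [] := @saito_reduce J (a h) (dot (cst (a h))) (linprod (J :\: R)) d1
  #|J :\: R| c t1 t2 _ _ _ _ _ c0 h1 h2 E.
- by move=> F t s; rewrite dotDr dotNr dotZr.
- by move=> t ht; apply: terao_restriction tr ht.
- by have := homog_dot (homog_cst (a h)) hd1; rewrite add0n.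
- exact: homog_linprod.
- by lia.
move=> s1 [s2 [c' [c'0 hs1 hs2 Es hk]]].
exists s1, (lin (a h) *: s2), c'; split; first exact: c'0.
- exact: tangentU1.
- apply: tangentU1; first exact: tangentZ.
  by rewrite dotZr; apply/pdvdMr/pdvd_refl.
by rewrite det3Zr Es linprodU1 // mulrCA.
Qed.

(** The minors of [euler K] and [t] vanish on the plane [v], so that [t] is there
    a multiple of the Euler derivation with a possible denominator; two
    coordinates which are coprime on the plane show that there is none. *)
Lemma euler_mod (v w : 'rV[K]_3) t : v != 0 -> dot v w != 0 ->
  pdvd (lin v) (dot (cst v) t) -> pdvd (lin v) (det3 (euler K) (cst w) t) ->
  exists g s, t = g *: euler K + lin v *: s.
Proof.
move=> v0 vw; have [phi [phic H]] := quotient_lin v0.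
move=> /H vt /H wt.
have cr : cross (map_mx phi (euler K)) (map_mx phi t) = 0.
  apply: (@cross_perp_det _ (cst v) _ (cst w)).
  - by rewrite dot_cst mpolyC_eq0.
  - by rewrite -(phic v) dot_map; apply/H/pdvd_refl.
  - by rewrite -(phic v) dot_map.
  - by rewrite -(phic w) det3_map.
have minor (i j : 'I_3) : pdvd (lin v) ('X_j * t 0 i - 'X_i * t 0 j).
  apply/H; rewrite rmorphB !rmorphM /=.
  have /rowP /(_ j) := cross_eq0_scale i cr; rewrite !mxE => <-.
  by rewrite [phi (t 0 i) * _]mulrC subrr.
have linX (i : 'I_3) : 'X_i = lin (delta_mx 0 i) :> S.
  rewrite /lin /dot !mxE; move: i; apply: ord3_ind; rewrite /= mpolyC1 mpolyC0;
  by rewrite !mul0r mul1r ?addr0 ?add0r.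
have [i [j dij]] : exists i j : 'I_3,
    det3 (delta_mx 0 j) v (delta_mx 0 i) != 0.
  have [k vk] := row_neq0P v0; move: k vk; apply: ord3_ind => vk.
  - exists o1, o2; apply: contraNneq vk => <-; apply/eqP.
    by rewrite /det3 /dot !crossE !mxE /=; ring.
  - exists o2, o0; apply: contraNneq vk => <-; apply/eqP.
    by rewrite /det3 /dot !crossE !mxE /=; ring.
  - exists o0, o1; apply: contraNneq vk => <-; apply/eqP.
    by rewrite /det3 /dot !crossE !mxE /=; ring.
have vi : cross v (delta_mx 0 i) != 0.
  by apply: contraNneq dij => vi; rewrite /det3 vi dot0r.
have [g [s Et]] : exists g s : S, t 0 i = s * lin v + g * 'X_i.
  have : ideal2 (lin v) (lin (delta_mx 0 i)) ('X_j * t 0 i).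
    have [x Ex] := minor i j; exists x, (t 0 j).
    by rewrite -Ex -linX [t 0 j * _]mulrC subrK.
  case/(ideal2_prime vi) => [|[s [g ->]]]; last by exists g, s; rewrite linX.
  by rewrite linX => /(ideal2_lin _ vi) d0; rewrite d0 eqxx in dij.
have : forall l, exists q, t 0 l - g * 'X_l = q * lin v.
  move=> l; have : pdvd (lin v) ('X_i * (t 0 l - g * 'X_l)).
    have -> : 'X_i * (t 0 l - g * 'X_l) =
        - ('X_l * t 0 i - 'X_i * t 0 l) + 'X_l * (s * lin v).
      rewrite Et; move: (t 0 l) (lin v) ('X_i : S) ('X_l : S) => x y z u; clear; ring.
    apply: pdvdD; last by rewrite mulrA; apply/pdvdMl/pdvd_refl.
    by rewrite -mulN1r; apply/pdvdMl/minor.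
  case/(lin_prime v0) => [|[q ->]]; last by exists q.
  by rewrite linX => /(pdvd_lin vi).
case/fin_all_exists => q Eq; exists g, (\row_l q l).
apply/rowP => l; rewrite !mxE.
by rewrite [lin v * _]mulrC -(Eq l) addrC subrK.
Qed.

Lemma ideal2_linprod_points (v : 'rV[K]_3) R F : v != 0 ->
  (forall r, r \in R -> cross v (a r) != 0) ->
  (forall r s : I, r \in R -> s \in R -> r != s -> det3 v (a r) (a s) != 0) ->
  (forall r, r \in R -> ideal2 (lin v) (lin (a r)) F) ->
  ideal2 (lin v) (linprod R) F.
Proof.
move=> v0; elim/set_ind1: R => [_ _ _|r R rR IH vR sep HF].
  by apply: pdvd_ideal2r; exists F; rewrite /linprod big_set0 mulr1.
have rRr : r \in r |: R by apply: setU11.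
have -> : linprod (r |: R) = linprod [set r] * linprod R.
  by rewrite linprodU1 // /linprod big_set1.
apply: ideal2_linprod => //.
- move=> i /set1P ->; have vr := vR _ rRr; split=> //.
  have [phi [_ H]] := quotient_lin2 vr.
  move/H/eqP; rewrite rmorph_prod prodf_seq_eq0 => /hasP [s _].
  case/andP=> sR /eqP /H /(ideal2_lin _ vr) d.
  have rs : r != s by apply: contraNneq rR => ->.
  by have := sep _ _ rRr (setU1r _ sR) rs; rewrite -det3_rot d eqxx.
- rewrite [linprod [set r]]big_set1; exact: HF.
apply: IH => [s sR|s s' sR sR'|s sR].
- exact/vR/setU1r.
- by apply: sep; apply: setU1r.
exact/HF/setU1r.
Qed.

(** Deletion. For [w] outside [h], the determinant of the Euler derivation, [w]
    and a logarithmic derivation restricts to [h] as a multiple of a form of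
    degree [#|R|], with one linear factor for each point of [h]. A derivation for
    which it vanishes on [h] is divisible by [lin (a h)], up to a multiple of the
    Euler derivation, by [euler_mod]. *)
Lemma saito_del h J R : h \in J -> transversal h (J :\ h) R ->
  (#|J| <= 2 * #|R|)%N -> saito J -> saito (J :\ h).
Proof.
move=> hJ tr cR /saito_homogW [t1 [t2 [c [d1 [d2 [[c0 h1 h2 E] hd1 hd2 d12 dJ]]]]]].
have [RJ _ _ sep] := tr; have [w hw] := dot_eq1 (a_neq0 h).
have hr r : r \in R -> h != r /\ r \in J.
  by move/(subsetP RJ); rewrite !inE eq_sym => /andP [].
have [] := @saito_reduce J (a h) (det3 (euler K) (cst w)) (linprod R) d1.+1
  #|R| c t1 t2 _ _ _ _ _ c0 h1 h2 E.
- by move=> F t s; rewrite det3Dr det3Nr det3Zr.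
- move=> t ht; apply: ideal2_linprod_points => //.
    by move=> r /hr [hr' _]; apply: a_indep.
  move=> r /hr [hr' rJ]; apply: (det3_ideal2 _ (a_indep hr')).
  + exact/pdvd_ideal2l/pdvd_refl.
  + exact/pdvd_ideal2r/pdvd_refl.
  + exact/pdvd_ideal2l/ht.
  + exact/pdvd_ideal2r/ht.
- by have := homog_det3 (homog_euler K) (homog_cst w) hd1; rewrite add0n add1n.
- exact: homog_linprod.
- by lia.
move=> s1 [s2 [c' [c'0 hs1 hs2 Es hk]]].
have hw0 : dot (a h) w != 0 by rewrite hw oner_eq0.
have [g [s E1]] := euler_mod (a_neq0 h) hw0 (hs1 h hJ) hk.
exists s, s2, c'; split; first exact: c'0.
- move=> i; rewrite !inE => /andP [ih iJ].
  have : pdvd (lin (a i)) (lin (a h) * dot (cst (a i)) s).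
    have -> : lin (a h) * dot (cst (a i)) s = dot (cst (a i)) (s1 - g *: euler K).
      by rewrite E1 addrC addKr dotZr.
    rewrite dotDr dotNr dotZr; apply: pdvdB; first exact: hs1.
    exact/pdvdMl/pdvd_refl.
  case/(lin_prime (a_neq0 i)) => [/(pdvd_lin (a_indep ih)) []|D]; exact: D.
- by apply: tangent_sub hs2; apply: subD1set.
apply: (mulfI (_ : lin (a h) != 0)); first by rewrite lin_eq0.
rewrite -det3Zm -(det3_addm g) -E1 Es (linprodD1 _ hJ).
exact: mulrCA.
Qed.
End AdditionDeletion.

(** * Arrangements with a point of large multiplicity *)

Section Pencil.
Variables (K : fieldType) (I : finType) (a : I -> 'rV[K]_3).
Hypothesis a_neq0 : forall i, a i != 0.
Hypothesis a_indep : forall i j, i != j -> cross (a i) (a j) != 0.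
Local Notation S := {mpoly K[3]}.
Local Notation tangent := (tangent a).
Local Notation linprod := (linprod a).
Local Notation transversal := (transversal a).
Local Notation saito := (saito a).
Local Notation conc := (conc a).
Variables (i0 j0 : I).
Hypothesis ij0 : i0 != j0.
Implicit Types (i j h r s : I) (J L : {set I}) (t : 'rV[S]_3) (F G : S).

Definition pencil J := [set i in J | conc i0 j0 i].

(** The lines [i] and [j] meet in a point, other than the center of the pencil,
    through which no line of the pencil passes. *)
Definition offpencil J i j :=
  [&& i \in J :\: pencil J, j \in J :\: pencil J, i != j &
      [forall r in pencil J, ~~ conc i j r]].

Definition center := cross (a i0) (a j0).
Local Notation v := center.

Lemma center_neq0 : v != 0.
Proof. exact: a_indep. Qed.

Lemma in_pencil J i : (i \in pencil J) = (i \in J) && (dot v (a i) == 0).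
Proof. by rewrite inE /conc det3_dotr. Qed.

Lemma pencil_sub J : pencil J \subset J.
Proof. by apply/subsetP => i; rewrite in_pencil => /andP []. Qed.

Lemma notin_pencil J i : i \in J :\: pencil J -> i \in J /\ dot v (a i) != 0.
Proof. by rewrite inE in_pencil andbC; case/andP => iJ; rewrite iJ. Qed.

Lemma pencil_sep J h r s : h \in J :\: pencil J ->
  r \in pencil J -> s \in pencil J -> r != s -> ~~ conc h r s.
Proof.
move=> /notin_pencil [_ vh]; rewrite !in_pencil => /andP [_ /eqP vr].
case/andP=> _ /eqP vs rs; apply: contra vh => /eqP d.
have [x [y ->]] := dep3_comb (a_indep rs) d.
by rewrite dotDr !dotZr vr vs !mulr0 addr0.
Qed.

Lemma cards_pencilD J : (#|J| = #|pencil J| + #|J :\: pencil J|)%N.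
Proof. by rewrite -(cardsID (pencil J) J); move/setIidPr: (pencil_sub J) => ->. Qed.

Section Supersolvable.
Variable J : {set I}.
Hypothesis i0J : i0 \in J.
Hypothesis good : forall i j, ~~ offpencil J i j.

Lemma transversal_pencil h L : L \subset J :\: pencil J ->
  h \in J :\: pencil J -> h \notin L ->
  transversal h (pencil J :|: L) (pencil J).
Proof.
move=> LJ hJ hL; split.
- exact: subsetUl.
- by rewrite in_setU negb_or hL andbT; case/setDP: hJ.
- move=> i /setDP [/setUP [iP /negP //|iL] _].
  have := good h i; rewrite /offpencil hJ (subsetP LJ _ iL) /=.
  rewrite negb_and negbK => /orP [/eqP hi|]; first by rewrite hi iL in hL.
  rewrite negb_forall => /existsP [r]; rewrite negb_imply negbK => /andP [rP c].
  by exists r => //; rewrite conc_swap.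
by move=> r s; apply: pencil_sep.
Qed.

(** The derivation is extended from one line to the next. By
    [terao_restriction] its value on the new form is, along the new line, a
    multiple of the product of the previous lines off the pencil; a multiple of
    this product times the constant derivation towards the center corrects it,
    and leaves the determinant unchanged. *)
Lemma supersolvable_member L : L \subset J :\: pencil J ->
  exists2 t, tangent (pencil J :|: L) t &
    det3 (euler K) (cst v) t = linprod (pencil J).
Proof.
elim/set_ind1: L => [_|h L hL IH hLJ].
  have [u vu] := dot_eq1 center_neq0.
  have i0P : i0 \in pencil J by rewrite inE i0J /conc det3_rot det3_eqr /=.
  exists (linprod (pencil J :\ i0) *: cst (cross (a i0) u)).
    rewrite setU0 => j jP; rewrite dotZr.
    have [->|ji] := eqVneq j i0.
      by rewrite dot_cst -[dot _ _]/(det3 _ _ _) det3_eql mpolyC0 mulr0; apply: pdvd0.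
    rewrite (linprodD1 _ (_ : j \in _)); last by rewrite in_setD1 ji.
    by apply/pdvdMr/pdvdMr/pdvd_refl.
  have Elin : det3 (euler K) (cst v) (cst (cross (a i0) u)) = lin (a i0).
    rewrite /det3 cross_cst crossA vu scale1r.
    have -> : dot v (a i0) = 0 by rewrite -det3_dotr det3_rot det3_eqr.
    by rewrite scale0r subr0 dotC.
  by rewrite det3Zr Elin mulrC -linprodD1.
have hJ : h \in J :\: pencil J by apply: (subsetP hLJ); apply: setU11.
have LJ : L \subset J :\: pencil J.
  by apply: subset_trans hLJ; apply: subsetUr.
have [t ht Et] := IH LJ; have [_ vh] := notin_pencil hJ.
have := terao_restriction a_neq0 a_indep (transversal_pencil LJ hJ hL) ht.
rewrite setDUl setDv set0U (_ : L :\: pencil J = L); last first.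
  apply/setDidPl; rewrite -setI_eq0 -subset0; apply/subsetP => i.
  by case/setIP=> /(subsetP LJ) /setDP [_ /negP].
case=> x [y Eh]; set c := dot v (a h) in vh.
exists (t - (y * (c^-1)%:MP * linprod L) *: cst v); last first.
  by rewrite det3Dr det3Nr det3Zr det3_eqr mulr0 subr0.
rewrite setUCA; apply: tangentU1.
  apply: tangentB => // i; rewrite dotZr dot_cst dotC => /setUP [iP|iL].
    have /eqP -> : dot v (a i) == 0 by move: iP; rewrite in_pencil => /andP [].
    by rewrite mpolyC0 mulr0; apply: pdvd0.
  apply/pdvdMr/pdvdMl; rewrite (linprodD1 _ iL).
  by apply/pdvdMr/pdvd_refl.
exists x; rewrite dotDr dotNr dotZr dot_cst [dot (a h) v]dotC Eh -/c.
have -> : y * (c^-1)%:MP * linprod L * c%:MP = y * linprod L * (c^-1 * c)%:MP.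
  by rewrite mpolyCM -!mulrA; congr (_ * _); rewrite mulrCA.
by rewrite mulVf // mpolyC1 mulr1 addrK.
Qed.

Lemma saito_supersolvable : saito J.
Proof.
have [t] := supersolvable_member (subxx _).
have EJ : pencil J :|: J :\: pencil J = J.
  by rewrite -[RHS](setID J (pencil J)) (setIidPr (pencil_sub J)).
rewrite EJ => tJ E; set L := J :\: pencil J.
exists (linprod L *: cst v), t, 1; split.
- exact: oner_neq0.
- move=> i iJ; rewrite dotZr dot_cst dotC.
  have [iP|iP] := boolP (i \in pencil J).
    have /eqP -> : dot v (a i) == 0 by move: iP; rewrite in_pencil => /andP [].
    by rewrite mpolyC0 mulr0; apply: pdvd0.
  have iL : i \in L by rewrite in_setD iP.
  by apply: pdvdMr; rewrite (linprodD1 _ iL); apply/pdvdMr/pdvd_refl.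
- exact: tJ.
by rewrite det3Zm E mpolyC1 mul1r (linprodID _ (pencil_sub J)) mulrC.
Qed.
End Supersolvable.

Section OffPencil.
Variable J : {set I}.
Local Notation m := #|pencil J|.
Local Notation k := #|J :\: pencil J|.

(** Along a line off the pencil [t] is proportional to the Euler derivation, so
    the minors of the two are multiples of the product of these lines. By
    degree the factors are constants, and a linear relation between the
    coordinates, which the minors satisfy, has zero coefficients. *)
Lemma wedge_degree t d : tangent J t -> homrow d t ->
  det3 (euler K) (cst v) t = 0 -> (d < k)%N -> cross (euler K) t = 0.
Proof.
move=> tJ hd D0 dk; set N := cross _ _.
have hN : homrow (1 + d) N by apply: homog_cross => //; apply: homog_euler.
have dvN l : pdvd (linprod (J :\: pencil J)) (N 0 l).
  apply: (linprod_dvd a_neq0 a_indep) => i /notin_pencil [iJ vi].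
  have [phi [phic H]] := quotient_lin (a_neq0 i); apply/H.
  suff : map_mx phi N = 0 by move/rowP/(_ l); rewrite !mxE.
  rewrite -cross_map; apply: (@cross_perp_det _ (cst (a i)) _ (cst v)).
  - by rewrite dot_cst mpolyC_eq0 dotC.
  - by rewrite -(phic (a i)) dot_map; apply/H/pdvd_refl.
  - by rewrite -(phic (a i)) dot_map; apply/H/tJ.
  - by rewrite -(phic v) det3_map D0 rmorph0.
move: dk; rewrite leq_eqVlt => /orP [/eqP dk|dk]; last first.
  apply/rowP => l; rewrite [RHS]mxE.
  by apply: (homog_pdvd_lt (hN l) (homog_linprod _ _) (dvN l)).
have : forall l, exists c : K, N 0 l = c%:MP * linprod (J :\: pencil J).
  move=> l; have := hN l; rewrite add1n dk -[k in X in X -> _]add0n => hNl.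
  have [q /homog0C Eq ->] := homog_pdvd hNl (homog_linprod _ _) (dvN l).
  by rewrite Eq; eexists.
case/fin_all_exists => c Ec.
have EN : N = linprod (J :\: pencil J) *: cst (\row_l c l).
  by apply/rowP => l; rewrite Ec !mxE mulrC.
have : linprod (J :\: pencil J) * lin (\row_l c l) = 0.
  have <- : dot N (euler K) = 0 by rewrite -det3_dotr det3_rot det3_eqr.
  by rewrite EN dotC dotZr dotC.
move/eqP; rewrite mulf_eq0 (negPf (linprod_neq0 a_neq0 _)) lin_eq0 /=.
by move/eqP=> c0; rewrite EN c0; apply/rowP => l; rewrite !mxE mpolyC0 mulr0.
Qed.

Lemma pencil_dvd t : tangent J t ->
  pdvd (linprod (pencil J)) (det3 (euler K) (cst v) t).
Proof.
move=> tJ; apply: (linprod_dvd a_neq0 a_indep) => i.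
rewrite in_pencil => /andP [iJ /eqP vi]; apply: det3_pdvd => //.
- exact: pdvd_refl.
- by rewrite dot_cst dotC vi mpolyC0; apply: pdvd0.
exact: tJ.
Qed.

(** At the common point of [i] and [j] the derivation [t] is proportional to the
    Euler derivation, and no form of the pencil vanishes. *)
Lemma offpencil_vanish t i j F : offpencil J i j -> tangent J t ->
  det3 (euler K) (cst v) t = F * linprod (pencil J) ->
  ideal2 (lin (a i)) (lin (a j)) F.
Proof.
case/and4P=> iJ jJ ij /forallP sep tJ E.
have [iJ' _] := notin_pencil iJ; have [jJ' _] := notin_pencil jJ.
have : ideal2 (lin (a i)) (lin (a j)) (F * linprod (pencil J)).
  rewrite -E; apply: (det3_ideal2 _ (a_indep ij)).
  - exact/pdvd_ideal2l/pdvd_refl.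
  - exact/pdvd_ideal2r/pdvd_refl.
  - exact/pdvd_ideal2l/tJ.
  - exact/pdvd_ideal2r/tJ.
case/(ideal2_prime (a_indep ij)) => [D|]; first exact: D.
case/(ideal2_linprodP a_indep ij) => r rP c.
by have := sep r; rewrite rP c.
Qed.

Lemma ideal2_const i j (c : K) : i != j ->
  ideal2 (lin (a i)) (lin (a j)) c%:MP -> c = 0.
Proof.
move=> ij D; have [phi [phic H]] := quotient_lin2 (a_indep ij).
have := phic (const_mx c) => /rowP /(_ 0); rewrite !mxE.
by move/H: D => -> /esym /eqP; rewrite mpolyC_eq0 => /eqP.
Qed.

(** The quotient by the forms of the pencil is a constant by degree, and it
    vanishes at a point. *)
Lemma low_degree t d i j : offpencil J i j -> tangent J t -> homrow d t ->
  (d < m)%N -> det3 (euler K) (cst v) t = 0.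
Proof.
move=> bad tJ hd; have hdet := homog_det3 (homog_euler K) (homog_cst v) hd.
rewrite leq_eqVlt => /orP [/eqP dm|dm]; last first.
  by apply: (homog_pdvd_lt hdet (homog_linprod _ _) (pencil_dvd tJ)).
rewrite add0n add1n dm -[m in X in _ \is X]add0n in hdet.
have [q /homog0C Eq Edet] := homog_pdvd hdet (homog_linprod _ _) (pencil_dvd tJ).
have := offpencil_vanish bad tJ Edet; rewrite Eq => /ideal2_const.
by move=> q0; rewrite Edet Eq q0 ?mpolyC0 ?mul0r //; case/and4P: bad.
Qed.

Lemma wedge_center t1 t2 :
  det3 (euler K) (cst v) t1 = 0 -> det3 (euler K) (cst v) t2 = 0 ->
  det3 (euler K) t1 t2 = 0.
Proof.
move=> D1 D2; apply: (det3_wedges (a := cst (a i0)) _ _ _ D1 D2).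
- by rewrite dot_cst dotC -det3_dotr det3_rot det3_eqr mpolyC0.
- by rewrite -/(lin (a i0)) lin_eq0.
- by rewrite cst_eq0 center_neq0.
Qed.

(** The degrees of a basis add up to [m + k - 1]. If the determinant of the
    smaller member vanished, its degree would be at least [k], the other degree
    less than [m], and both determinants would vanish. So the smaller degree is
    at least [m], hence equal to [m], and the quotient of the determinant by the
    forms of the pencil is the linear form [u]. *)
Lemma offpencil_linear i j : i0 \in J -> (#|J| <= 2 * m + 2)%N -> saito J ->
  offpencil J i j ->
  (2 * m + 1 <= #|J|)%N /\ exists2 u : 'rV[K]_3, u != 0 &
    forall i' j', offpencil J i' j' -> det3 u (a i') (a j') = 0.
Proof.
move=> i0J Jm; move/(saito_homogW a_neq0 a_indep).
move=> [t1 [t2 [c [d1 [d2 [[c0 h1 h2 E] hd1 hd2 d12 dJ]]]]]] bad.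
have Jmk := cards_pencilD J.
have E0 : det3 (euler K) t1 t2 != 0.
  by rewrite E mulf_neq0 ?mpolyC_eq0 ?linprod_neq0.
have D1 : det3 (euler K) (cst v) t1 != 0.
  apply: contraNneq E0 => D1; have [d1k|d1k] := ltnP d1 k.
    by rewrite det3_dotr (wedge_degree h1 hd1 D1 d1k) dotC dot0r.
  have d2m : (d2 < m)%N by lia.
  by rewrite (wedge_center D1 (low_degree bad h2 hd2 d2m)).
have d1m : (m <= d1)%N.
  by rewrite leqNgt; apply: contra D1 => lt; rewrite (low_degree bad h1 hd1 lt).
split; first by lia.
have hdet := homog_det3 (homog_euler K) (homog_cst v) hd1.
have Ed1 : d1 = m by lia.
rewrite add0n Ed1 in hdet.
have [F /homog1_lin [u Eu] Edet] := homog_pdvd hdet (homog_linprod _ _) (pencil_dvd h1).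
exists u; first by rewrite -lin_eq0 -Eu; apply: contraNneq D1 => F0; rewrite Edet F0 mul0r.
move=> i' j' bad'; apply/ideal2_lin; first by apply: a_indep; case/and4P: bad'.
by rewrite -Eu; apply: (offpencil_vanish bad' h1 Edet).
Qed.

Lemma offpencil_sym i j : offpencil J i j -> offpencil J j i.
Proof.
case/and4P=> iJ jJ ij /forallP sep; apply/and4P; split=> //.
  by rewrite eq_sym.
apply/forallP => r; apply/implyP => rP; have := sep r; rewrite rP /=.
by rewrite conc_sym conc_swap -conc_sym.
Qed.

(** All the points in question lie on the line [u]; if [i] and [j] both carried
    two of them, [u] would be equal to both. *)
Lemma line_with_one_point (u : 'rV[K]_3) i j : u != 0 ->
  (forall i' j', offpencil J i' j' -> det3 u (a i') (a j') = 0) ->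
  offpencil J i j ->
  exists h h', offpencil J h h' /\ forall l, offpencil J h l -> conc h h' l.
Proof.
move=> u0 hu bad.
have key h h' : offpencil J h h' ->
    (forall l, offpencil J h l -> conc h h' l) \/ cross u (a h) = 0.
  move=> bad'; case: (boolP [forall l, offpencil J h l ==> conc h h' l]).
    by move/forallP=> H; left=> l; apply/implyP.
  rewrite negb_forall => /existsP [l]; rewrite negb_imply => /andP [badl nc].
  have dotl x y : dot (cross x y) x = 0 :> K by rewrite -det3_dotr det3_rot det3_eqr.
  right; apply: (@cross_perp _ (cross (a h) (a h')) (cross (a h) (a l))).
  - rewrite crossA dotl scale0r subr0 scalemx_eq0 negb_or a_neq0 andbT.
    by rewrite -det3_dotr.
  - by rewrite -det3_dotr -det3_rot hu.
  - by rewrite -det3_dotr -det3_rot hu.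
  - exact: dotl.
  - exact: dotl.
have [ok|ui] := key _ _ bad; first by exists i, j.
have bad' := offpencil_sym bad.
have [ok|uj] := key _ _ bad'; first by exists j, i.
have /a_indep/eqP [] : i != j by case/and4P: bad.
exact: (cross_trans u0).
Qed.

Lemma transversal_offpencil h h' : offpencil J h h' ->
  (forall l, offpencil J h l -> conc h h' l) ->
  transversal h (J :\ h) (h' |: pencil J) /\ h' \notin pencil J.
Proof.
move=> bad one; case/and4P: (bad) => hJ h'J hh' /forallP sep.
have [hJ' _] := notin_pencil hJ; have [h'J' _] := notin_pencil h'J.
have hP : h \notin pencil J by case/setDP: hJ.
have h'P : h' \notin pencil J by case/setDP: h'J.
split=> //; split.
- apply/subsetP => i; rewrite in_setD1 => /setU1P [->|iP].
    by rewrite eq_sym hh'.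
  by rewrite (subsetP (pencil_sub J) _ iP) andbT; apply: contraNneq hP => <-.
- by rewrite setD11.
- move=> i /setDP [/setD1P [ih iJ]]; rewrite in_setU1 negb_or => /andP [ih' iP].
  have [badi|] := boolP (offpencil J h i); first by exists h'; [apply: setU11|apply: one].
  rewrite /offpencil hJ in_setD iP iJ eq_sym ih /= negb_forall => /existsP [r].
  rewrite negb_imply negbK => /andP [rP c].
  by exists r; [apply: setU1r|rewrite conc_swap].
move=> r s /setU1P [->|rP] /setU1P [->|sP]; rewrite ?eqxx // => rs.
- by have := sep s; rewrite sP.
- by have := sep r; rewrite rP conc_swap.
exact: (pencil_sep hJ).
Qed.
End OffPencil.
End Pencil.

(** A line with exactly one point off the pencil has [m + 1] points. When the
    number of lines is [2m + 1] or [2m + 2], this number of points satisfies both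
    numerical conditions, for adding and for deleting this line, so that
    freeness is the same with and without it. *)
Theorem saito_combinatorial (K : fieldType) (I : finType) (a a' : I -> 'rV[K]_3)
    (i0 j0 : I) (J : {set I}) :
  (forall i, a i != 0) -> (forall i, a' i != 0) ->
  (forall i j, i != j -> cross (a i) (a j) != 0) ->
  (forall i j, i != j -> cross (a' i) (a' j) != 0) ->
  (forall i j k, conc a i j k = conc a' i j k) ->
  i0 != j0 -> i0 \in J -> (#|J| <= 2 * #|pencil a i0 j0 J| + 2)%N ->
  saito a J -> saito a' J.
Proof.
move=> a0 a'0 aI a'I Hc ij0.
have Hp L : pencil a' i0 j0 L = pencil a i0 j0 L.
  by apply/setP => i; rewrite !inE Hc.
have Ho L i j : offpencil a' i0 j0 L i j = offpencil a i0 j0 L i j.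
  by rewrite /offpencil Hp; under eq_forallb do rewrite -Hc.
have Ht h L R : transversal a h L R -> transversal a' h L R.
  case=> RL hL cov sep; split=> // [i /cov [r rR c]|r s rR sR rs].
    by exists r; rewrite -?Hc.
  by rewrite -Hc sep.
move: {2}#|J|.+1 (ltnSn #|J|) => n; elim: n J => [J|n IH J Jn i0J Jm HJ].
  by move=> J0; exfalso; rewrite ltn0 in J0.
have [/existsP [i /existsP [j bad]]|good] :=
    boolP [exists i, exists j, offpencil a i0 j0 J i j]; last first.
  apply: (saito_supersolvable a'0 a'I ij0 i0J) => i j; rewrite Ho.
  by apply: contra good => bad; apply/existsP; exists i; apply/existsP; exists j.
have [mJ [u u0 hu]] := offpencil_linear a0 aI ij0 i0J Jm HJ bad.
have [h [h' [badh one]]] := line_with_one_point a0 aI u0 hu bad.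
have [tr h'P] := transversal_offpencil aI badh one.
have hJP : h \in J :\: pencil a i0 j0 J by case/and4P: badh.
have [hJ hP] := setDP hJP.
have cR : #|h' |: pencil a i0 j0 J| = (#|pencil a i0 j0 J|).+1.
  by rewrite cardsU1 h'P.
have cJ : #|J| = (#|J :\ h|).+1 by rewrite (cardsD1 h) hJ.
have Ph : pencil a i0 j0 (J :\ h) = pencil a i0 j0 J.
  apply/setP => l; rewrite !inE; case: eqVneq => [->|//].
  by move: hP; rewrite inE hJ /= => /negbTE ->.
have i0h : i0 \in J :\ h.
  rewrite in_setD1 i0J andbT; apply: contraNneq hP => <-.
  by rewrite inE i0J /conc det3_rot det3_eqr /=.
have Hdel : saito a (J :\ h).
  by apply: (saito_del a0 aI hJ tr _ HJ); rewrite cR; lia.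
rewrite -(setD1K hJ); apply: (saito_add a'0 a'I (Ht _ _ _ tr)).
  by rewrite cR; lia.
by apply: (IH _ _ i0h _ Hdel); rewrite ?Ph; lia.
Qed.

(** * Bases of the module of logarithmic derivations *)

Lemma det3_comb (A : comNzRingType) (x y z u v w p q r : 'rV[A]_3) :
  p = x 0 o0 *: u + x 0 o1 *: v + x 0 o2 *: w ->
  q = y 0 o0 *: u + y 0 o1 *: v + y 0 o2 *: w ->
  r = z 0 o0 *: u + z 0 o1 *: v + z 0 o2 *: w ->
  det3 p q r = det3 x y z * det3 u v w.
Proof. by move=> -> -> ->; rewrite /det3 /dot !mxE /=; ring. Qed.

Lemma det3_scale3 (A : comNzRingType) (p q : A) (u v w : 'rV[A]_3) :
  det3 (p *: u) (p *: v) (q *: w) = p * p * q * det3 u v w.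
Proof. by rewrite /det3 /dot !mxE /=; ring. Qed.

Lemma det3_subst (A : comNzRingType) (x y z : A) (u v w p : 'rV[A]_3) :
  p = x *: u + y *: v + z *: w ->
  [/\ det3 p v w = x * det3 u v w, det3 p w u = y * det3 u v w &
      det3 p u v = z * det3 u v w].
Proof. by move=> ->; split; rewrite /det3 /dot !mxE /=; ring. Qed.

Lemma cramer3_div (A : idomainType) (u v w t : 'rV[A]_3) (d d' P x y z : A) :
  P != 0 -> d' * d = 1 -> det3 u v w = d * P ->
  det3 t v w = x * P -> det3 u t w = y * P -> det3 u v t = z * P ->
  t = (d' * x) *: u + (d' * y) *: v + (d' * z) *: w.
Proof.
move=> P0 dd E Ex Ey Ez; have := cramer3 u v w t; rewrite E Ex Ey Ez => Et.
apply/eqP; rewrite -subr_eq0; suff : P *: (t - (d' * x *: u + d' * y *: v + d' * z *: w)) = 0.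
  by move/eqP; rewrite scalemx_eq0 (negPf P0).
rewrite scalerBr.
have -> : P *: t = d' *: ((d * P) *: t) by rewrite scalerA mulrA dd mul1r.
by rewrite Et; apply/rowP => i; rewrite !mxE; ring.
Qed.

Lemma ex_frame (K : fieldType) (v : 'rV[K]_3) : v != 0 ->
  exists w1 w2 w3, [/\ dot v w1 = 0, dot v w2 = 0 & det3 w1 w2 w3 != 0].
Proof.
move=> /row_neq0P [i vi].
have [e [f ef]] : exists e f : 'rV[K]_3, det3 v e f != 0.
  move: i vi; apply: ord3_ind => vi.
  - exists (delta_mx 0 o1), (delta_mx 0 o2); apply: contraNneq vi => <-; apply/eqP.
    by rewrite /det3 /dot !mxE /=; ring.
  - exists (delta_mx 0 o2), (delta_mx 0 o0); apply: contraNneq vi => <-; apply/eqP.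
    by rewrite /det3 /dot !mxE /=; ring.
  - exists (delta_mx 0 o0), (delta_mx 0 o1); apply: contraNneq vi => <-; apply/eqP.
    by rewrite /det3 /dot !mxE /=; ring.
have v0 : v != 0 by apply: contraNneq ef => ->; rewrite det3_dotr crossNC cross0r oppr0 dotC dot0r.
have [u vu] := dot_eq1 v0.
exists (cross v e), (cross v f), u; split.
- exact: det3_eql.
- exact: det3_eql.
suff -> : det3 (cross v e) (cross v f) u = det3 v e f * dot v u.
  by rewrite vu mulr1.
by rewrite /det3 /dot !mxE /=; ring.
Qed.

Section SaitoOfBasis.
Variables (K : fieldType) (I : finType) (a : I -> 'rV[K]_3).
Hypothesis a_neq0 : forall i, a i != 0.
Hypothesis a_indep : forall i j, i != j -> cross (a i) (a j) != 0.
Local Notation S := {mpoly K[3]}.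
Local Notation tangent := (tangent a).
Local Notation linprod := (linprod a).
Local Notation saito := (saito a).
Implicit Types (i j : I) (J L : {set I}) (t b : 'rV[S]_3) (F G g q : S).

Lemma factor_linprod L g q F :
  (forall i, i \in L -> ~ pdvd (lin (a i)) g) ->
  g * q = F * linprod L -> exists q', g * q' = F.
Proof.
elim/set_ind1: L q F => [q F _ E|i L iL IH q F ng E].
  by exists q; rewrite E /linprod big_set0 mulr1.
have ng' j : j \in L -> ~ pdvd (lin (a j)) g by move=> jL; apply/ng/setU1r.
have E' : g * q = F * lin (a i) * linprod L by rewrite E linprodU1 // mulrA.
have [q' Eq'] := IH _ _ ng' E'.
have : pdvd (lin (a i)) (g * q') by exists F.
case/(lin_prime (a_neq0 i)) => [D|[x Ex]]; first by case: (ng i (setU11 _ _) D).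
exists x; apply: (mulIf (_ : lin (a i) != 0)); first by rewrite lin_eq0.
by rewrite -mulrA -Ex.
Qed.

Section Basis.
Variables (J : {set I}) (b0 b1 b2 : 'rV[S]_3).
Hypotheses (J0 : J != set0).
Hypotheses (h0 : tangent J b0) (h1 : tangent J b1) (h2 : tangent J b2).
Hypothesis span : forall t, tangent J t ->
  exists x : 'rV[S]_3, t = x 0 o0 *: b0 + x 0 o1 *: b1 + x 0 o2 *: b2.

(** The triple [(linprod J :\ i) w1, (linprod J :\ i) w2, linprod J w3], with
    [w1] and [w2] on the line [i], shows that the cofactor of [linprod J] in
    the determinant of a basis divides the square of [linprod (J :\ i)]; for
    varying [i] these squares have no common factor. *)
Lemma det_basis : exists2 g, det3 b0 b1 b2 = g * linprod J & g@_0%MM != 0.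
Proof.
have [g Eg] := det3_linprod a_neq0 a_indep h0 h1 h2; exists g => //.
have key i : i \in J -> exists (c : K) q, c != 0 /\
    g * q = c%:MP * linprod (J :\ i) * linprod (J :\ i).
  move=> iJ; have [w1 [w2 [w3 [aw1 aw2 dw]]]] := ex_frame (a_neq0 i).
  have tw w : dot (a i) w = 0 -> tangent J (linprod (J :\ i) *: cst w).
    move=> aw j jJ; rewrite dotZr; have [->|ji] := eqVneq j i.
      by rewrite dot_cst aw mpolyC0 mulr0; apply: pdvd0.
    rewrite (linprodD1 _ (_ : j \in _)); last by rewrite in_setD1 ji.
    by apply/pdvdMr/pdvdMr/pdvd_refl.
  have tw3 : tangent J (linprod J *: cst w3).
    move=> j jJ; rewrite dotZr (linprodD1 _ jJ).
    by apply/pdvdMr/pdvdMr/pdvd_refl.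
  have [x Ex] := span (tw _ aw1); have [y Ey] := span (tw _ aw2).
  have [z Ez] := span tw3.
  exists (det3 w1 w2 w3), (det3 x y z); split; first exact: dw.
  have := det3_comb Ex Ey Ez; rewrite det3_scale3 det3_map Eg => E.
  apply: (mulIf (linprod_neq0 a_neq0 J)); move: E.
  move: (linprod J) (linprod (J :\ i)) (det3 x y z) => P Q q; clear => E.
  by transitivity (q * (g * P)); [ring|rewrite -E; ring].
have mcoeff0M (p q : S) : (p * q)@_0%MM = p@_0%MM * q@_0%MM.
  by rewrite (rmorphM (mcoeff 0%MM)).
have ndvd i : i \in J -> ~ pdvd (lin (a i)) g.
  move=> iJ [x Ex]; have [c [q [c0 E]]] := key i iJ.
  have ni := lin_ndvd_linprod a_neq0 a_indep (negbT (setD11 i J)).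
  have : pdvd (lin (a i)) (c%:MP * linprod (J :\ i) * linprod (J :\ i)).
    by rewrite -E Ex; exists (x * q); rewrite mulrAC.
  case/(lin_prime (a_neq0 i)) => [|D]; last by case: ni.
  case/(lin_prime (a_neq0 i)) => [|D]; last by case: ni.
  have [phi [_ H]] := quotient_lin (a_neq0 i).
  case=> y Ey; have D : pdvd (lin (a i)) 1.
    exists (y * (c^-1)%:MP); rewrite mulrAC -Ey -mpolyCM divff //.
  by move/H/eqP: D; rewrite rmorph1 oner_eq0.
have [i iJ] := set0Pn _ J0; have [c [q [c0 E]]] := key i iJ.
have ndvd' j : j \in J :\ i -> ~ pdvd (lin (a j)) g.
  by case/setD1P=> _; apply: ndvd.
have [q' E'] := factor_linprod ndvd' E.
have [q'' E''] := factor_linprod ndvd' E'.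
have := congr1 (mcoeff 0%MM) E''; rewrite mcoeff0M mcoeffC eqxx mulr1 => Ec.
by apply: contraNneq c0 => g0; rewrite -Ec g0 mul0r.
Qed.

(** The Euler derivation can replace some member of a basis: it does not lie in
    the maximal ideal times the module, as its value on a line [i] is [lin i]
    itself. *)
Lemma saito_of_basis : saito J.
Proof.
have [g Eg g0] := det_basis.
have [x Ex] := span (@tangent_euler _ _ a J).
have [i iJ] := set0Pn _ J0.
have [g0' E0] := h0 iJ; have [g1 E1] := h1 iJ; have [g2 E2] := h2 iJ.
have mcoeff0M (p q : S) : (p * q)@_0%MM = p@_0%MM * q@_0%MM.
  by rewrite (rmorphM (mcoeff 0%MM)).
have E : x 0 o0 * g0' + x 0 o1 * g1 + x 0 o2 * g2 = 1.
  apply: (mulIf (_ : lin (a i) != 0)); first by rewrite lin_eq0.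
  rewrite mul1r {2}/lin Ex !dotDr !dotZr E0 E1 E2.
  by rewrite !mulrDl !mulrA.
have {E} := congr1 (mcoeff 0%MM) E.
rewrite mcoeffD [X in X + _]mcoeffD (mcoeff0M (x 0 o0)) (mcoeff0M (x 0 o1)).
rewrite (mcoeff0M (x 0 o2)) mcoeff1 eqxx => E.
have saitoI s1 s2 f : tangent J s1 -> tangent J s2 ->
    det3 (euler K) s1 s2 = f * (g * linprod J) -> f@_0%MM != 0 -> saito J.
  move=> hs1 hs2; rewrite mulrA => Es f0.
  have fg0 : (f * g)@_0%MM != 0 by rewrite mcoeff0M mulf_neq0.
  have [t1 [t2 [c [d1 [d2 [[c0 ht1 ht2 Et] _ _ _ _]]]]]] :=
    saito_homog a_neq0 a_indep hs1 hs2 Es fg0.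
  by exists t1, t2, c.
have [D0 D1 D2] := det3_subst Ex.
have [x0|x0] := eqVneq ((x 0 o0)@_0%MM) 0; last first.
  by apply: (saitoI _ _ _ h1 h2 _ x0); rewrite -Eg.
have [x1|x1] := eqVneq ((x 0 o1)@_0%MM) 0; last first.
  by apply: (saitoI _ _ _ h2 h0 _ x1); rewrite -Eg.
have [x2|x2] := eqVneq ((x 0 o2)@_0%MM) 0; last first.
  by apply: (saitoI _ _ _ h0 h1 _ x2); rewrite -Eg.
move/eqP: E; rewrite x0 x1 x2 !mul0r !addr0 eq_sym oner_eq0.
by [].
Qed.
End Basis.
End SaitoOfBasis.

Section BasisOfSaito.
Variables (K : fieldType) (I : finType) (a : I -> 'rV[K]_3).
Hypothesis a_neq0 : forall i, a i != 0.
Hypothesis a_indep : forall i j, i != j -> cross (a i) (a j) != 0.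
Local Notation S := {mpoly K[3]}.

(** Cramer's rule: the determinants which occur are divisible by
    [linprod a J]. *)
Lemma basis_of_saito J : saito a J -> exists t1 t2 : 'rV[S]_3,
  [/\ tangent a J t1, tangent a J t2, det3 (euler K) t1 t2 != 0 &
   forall t, tangent a J t ->
   exists x y z, t = x *: euler K + y *: t1 + z *: t2].
Proof.
move=> [t1 [t2 [c [c0 h1 h2 E]]]]; exists t1, t2; split.
- exact: h1.
- exact: h2.
- by rewrite E mulf_neq0 ?mpolyC_eq0 ?linprod_neq0.
move=> t ht; have he := @tangent_euler _ _ a J.
have [x Ex] := det3_linprod a_neq0 a_indep ht h1 h2.
have [y Ey] := det3_linprod a_neq0 a_indep he ht h2.
have [z Ez] := det3_linprod a_neq0 a_indep he h1 ht.
have cc : c^-1%:MP * c%:MP = 1 :> S by rewrite -mpolyCM mulVf // mpolyC1.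
have P0 := linprod_neq0 a_neq0 J.
exists ((c^-1)%:MP * x), ((c^-1)%:MP * y), ((c^-1)%:MP * z).
exact: (cramer3_div P0 cc E Ex Ey Ez).
Qed.
End BasisOfSaito.

(** * Free submodules of rank three *)

Section RankThree.
Variables (A : nzRingType) (V : lmodType A) (D : classical_sets.set V).

Lemma sum_scale_sub (s r : seq V) (c : V -> A) :
  uniq s -> uniq r -> {subset s <= r} ->
  \sum_(b <- s) c b *: b = \sum_(b <- r) (if b \in s then c b else 0) *: b.
Proof.
move=> us ur sub.
under [RHS]eq_bigr do rewrite (fun_if (fun z => z *: _)) scale0r.
rewrite -big_mkcond -big_filter; apply: perm_big.
apply: uniq_perm; rewrite ?filter_uniq // => b.
by rewrite mem_filter andb_idr // => /sub.
Qed.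

Lemma free_of_basis3 (b0 b1 b2 : V) : D b0 -> D b1 -> D b2 ->
  (forall x y z, x *: b0 + y *: b1 + z *: b2 = 0 -> [/\ x = 0, y = 0 & z = 0]) ->
  (forall v, D v -> exists x y z, v = x *: b0 + y *: b1 + z *: b2) ->
  free_submodule D.
Proof.
move=> D0 D1 D2 ind span.
have neq (x y z : A) : x *: b0 + y *: b1 + z *: b2 = 0 -> x != 0 \/ y != 0 -> False.
  by move=> /ind [-> -> _]; rewrite eqxx => -[].
have n01 : b0 != b1.
  apply/eqP => E; apply: (neq 1 (-1) 0); last by left; apply: oner_neq0.
  by rewrite E scale1r scaleN1r subrr scale0r addr0.
have n02 : b0 != b2.
  apply/eqP => E; apply: (neq 1 0 (-1)); last by left; apply: oner_neq0.
  by rewrite E scale1r scaleN1r scale0r addr0 subrr.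
have n12 : b1 != b2.
  apply/eqP => E; apply: (neq 0 1 (-1)); last by right; apply: oner_neq0.
  by rewrite E scale1r scaleN1r scale0r add0r subrr.
pose r := [:: b0; b1; b2].
have ur : uniq r by rewrite /= !inE negb_or n01 n02 n12.
have sumr (c : V -> A) : \sum_(b <- r) c b *: b = c b0 *: b0 + c b1 *: b1 + c b2 *: b2.
  by rewrite !big_cons big_nil addr0 addrA.
exists (fun b => b \in r); split.
- by move=> b; rewrite !inE => /or3P [] /eqP ->.
- move=> s c us sub; rewrite (sum_scale_sub _ us ur sub) sumr => /ind [c0 c1 c2] b bs.
  have := sub _ bs; rewrite !inE => /or3P [] /eqP Eb; subst b.
  + by move: c0; rewrite bs.
  + by move: c1; rewrite bs.
  + by move: c2; rewrite bs.
move=> w /span [x [y [z ->]]].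
exists r, (fun b => if b == b0 then x else if b == b1 then y else z); split=> //.
by rewrite sumr !eqxx [b1 == _]eq_sym (negPf n01) ![b2 == _]eq_sym (negPf n02) (negPf n12).
Qed.

(** Up to the scalar [Q], the coordinates of the elements of a basis [s] in
    the frame [e] and of [e] in the basis [s] are inverse matrices; comparing
    traces, [s] has three elements. *)
Lemma basis3_of_free (ev : V -> 'rV[A]_3) (e : 'I_3 -> V) (Q : A) :
  (forall c u v i, ev (c *: u + v) 0 i = c * ev u 0 i + ev v 0 i) ->
  commutative (@GRing.mul A) -> (forall x, x * Q = 0 -> x = 0) ->
  (forall n, n%:R = 0 :> A -> n = 0%N) ->
  (forall k, D (e k)) -> (forall k, ev (e k) = Q *: delta_mx 0 k) ->
  (forall v, D v -> Q *: v = \sum_k ev v 0 k *: e k) ->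
  free_submodule D ->
  exists b0 b1 b2, [/\ D b0, D b1, D b2 &
    forall v, D v -> exists x : 'rV[A]_3,
      v = x 0 o0 *: b0 + x 0 o1 *: b1 + x 0 o2 *: b2].
Proof.
move=> evl mulAC Qreg char0 De eve HQ [B [BD ind span]].
have : forall k, exists p : seq V * (V -> A), [/\ uniq p.1,
    forall b, b \in p.1 -> B b & e k = \sum_(b <- p.1) p.2 b *: b].
  by move=> k; have [s [c H]] := span _ (De k); exists (s, c).
case/fin_all_exists => p Hp.
pose s := undup ((p o0).1 ++ (p o1).1 ++ (p o2).1).
have us : uniq s by apply: undup_uniq.
have ps k : {subset (p k).1 <= s}.
  by move=> b; rewrite mem_undup !mem_cat; move: k; apply: ord3_ind => ->; rewrite ?orbT.
have sB b : b \in s -> B b.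
  rewrite mem_undup !mem_cat => /or3P [].
  - by have [_ H _] := Hp o0; apply: H.
  - by have [_ H _] := Hp o1; apply: H.
  - by have [_ H _] := Hp o2; apply: H.
pose C k b : A := if b \in (p k).1 then (p k).2 b else 0.
have eC k : e k = \sum_(b <- s) C k b *: b.
  by have [uk _ Ek] := Hp k; rewrite {1}Ek (sum_scale_sub _ uk us (@ps k)).
pose M v b := \sum_k ev v 0 k * C k b.
have expand v : D v -> Q *: v = \sum_(b <- s) M v b *: b.
  move=> /HQ ->; under eq_bigr do rewrite eC scaler_sumr.
  rewrite exchange_big /=; apply: eq_bigr => b _.
  by rewrite scaler_suml; apply: eq_bigr => k _; rewrite scalerA.
have diag b : b \in s -> M b b = Q.
  move=> bs; have Eb : \sum_(b' <- s) (M b b' - (if b' == b then Q else 0)) *: b' = 0.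
    under eq_bigr do rewrite scalerBl.
    rewrite big_split /= -expand; last exact/BD/sB.
    rewrite sumrN (bigD1_seq b) //= eqxx big1 ?addr0 ?subrr // => b' /negPf ->.
    by rewrite scale0r.
  have := ind s _ us (fun b bs => sB b bs) Eb b bs; rewrite eqxx => /eqP.
  by rewrite subr_eq0 => /eqP.
have size3 : size s = 3.
  have : (size s)%:R * Q = 3%:R * Q.
    transitivity (\sum_(b <- s) M b b).
      rewrite (eq_big_seq (fun=> Q)); last exact: diag.
      by rewrite big_const_seq count_predT iter_addr_0 mulr_natl.
    rewrite exchange_big /=.
    have EQ k : \sum_(b <- s) ev b 0 k * C k b = Q.
      have := congr1 (fun w : 'rV[A]_3 => w 0 k) (eve k).
      rewrite {1}eC !mxE !eqxx mulr1 => <-; elim/big_rec2: _ => [|b x y _ ->].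
        have := evl 1 0 0 k; rewrite scaler0 addr0 mul1r => /eqP.
        by rewrite -[X in X == _]addr0 (inj_eq (addrI _)) => /eqP.
      by rewrite evl mulAC.
    under eq_bigr do rewrite EQ.
    by rewrite big_const_ord iter_addr_0 mulr_natl.
  move=> E; apply/eqP; case: (ltngtP (size s) 3) => // lt.
    have : (3 - size s)%:R = 0 :> A.
      by apply: Qreg; rewrite natrB 1?ltnW // mulrBl E subrr.
    by move/char0; lia.
  have : (size s - 3)%:R = 0 :> A.
    by apply: Qreg; rewrite natrB 1?ltnW // mulrBl E subrr.
  by move/char0; lia.
have Bs b : B b -> b \in s.
  move=> Bb; apply/negPn/negP => bs.
  have ub : uniq (b :: s) by rewrite /= bs.
  have : Q = 0; last first.
    by move=> Q0; have := Qreg 1; rewrite Q0 mulr0 => /(_ erefl)/eqP; rewrite oner_eq0.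
  pose c b' := if b' == b then - Q else M b b'.
  have := ind (b :: s) c ub _ _ b (mem_head _ _); rewrite /c eqxx => H.
  apply: oppr_inj; rewrite oppr0; apply: H.
    by move=> b'; rewrite inE => /predU1P [->//|/sB].
  rewrite big_cons eqxx scaleNr expand; last exact: BD.
  rewrite addrC; apply/eqP; rewrite subr_eq0; apply/eqP/eq_big_seq => b' b's.
  by rewrite ifF //; apply: contraNF bs => /eqP <-.
have spans v : D v -> exists c, v = \sum_(b <- s) c b *: b.
  move=> /span [s' [c [us' s'B ->]]].
  by exists (fun b => if b \in s' then c b else 0); apply: sum_scale_sub => // b /s'B /Bs.
have sD b : b \in s -> D b by move=> /sB /BD.
move: size3 sD spans; clear; case: s => [//|b0 [//|b1 [//|b2 [|//]]]] _ sD spans.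
exists b0, b1, b2; split; try by apply: sD; rewrite !inE eqxx ?orbT.
move=> v /spans [c ->]; exists (\row_k [:: c b0; c b1; c b2]`_k).
by rewrite !mxE /= !big_cons big_nil addr0 addrA.
Qed.
End RankThree.

(** * Derivations of the polynomial ring *)

Section Derivations.
Variable R : realType.
Local Notation C := (R[i]%C).
Local Notation S := {mpoly C[3]}.
Local Notation E := 'rV[C]_3.

Definition deriv (t : 'rV[S]_3) : S -> S^o := fun f => \sum_i t 0 i * f^`M(i).

Definition coords (theta : S -> S^o) : 'rV[S]_3 := \row_i theta 'X_i.

Lemma coords_is_linear : linear coords.
Proof. by move=> c u v; apply/rowP => i; rewrite !mxE. Qed.

HB.instance Definition _ := GRing.isLinear.Build S (S -> S^o) 'rV[S]_3 _ coords
  coords_is_linear.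

Lemma derivationP t : derivation (deriv t : S -> S).
Proof.
split=> [c f g|f g]; rewrite /deriv.
  rewrite scaler_sumr -big_split /=; apply: eq_bigr => i _.
  by rewrite linearP mulrDr -scalerAr.
rewrite mulr_suml mulr_sumr -big_split /=; apply: eq_bigr => i _.
by rewrite mderivM mulrDr; congr (_ + _); [apply: mulrA|apply: mulrCA].
Qed.

Lemma coordsK t : coords (deriv t) = t.
Proof.
apply/rowP => i; rewrite mxE /deriv (bigD1 i) //= big1 ?addr0 => [|j ji].
  have UU : (U_(i) - U_(i) = 0 :> 'X_{1..3})%MM.
    by apply/mnmP => k; rewrite mnmBE mnm0E subnn.
  by rewrite mderivX mnm1E eqxx UU mpolyX0 scale1r mulr1.
by rewrite mderivX mnm1E eq_sym (negPf ji) scale0r mulr0.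
Qed.

Lemma derivK (theta : S -> S^o) : derivation (theta : S -> S) ->
  deriv (coords theta) = theta.
Proof.
move=> [lin leib]; apply/funext.
have thD f g : theta (f + g) = theta f + theta g.
  by have := lin 1 f g; rewrite !scale1r.
have th1 : theta 1 = 0.
  have := leib 1 1; rewrite !mulr1 mul1r => /eqP.
  by rewrite -[X in X == _]addr0 (inj_eq (addrI _)) eq_sym => /eqP.
have thC (c : C) : theta c%:MP = 0.
  have th0 : theta 0 = 0.
    have := thD 0 0; rewrite addr0 => /eqP.
    by rewrite -[X in X == _]addr0 (inj_eq (addrI _)) eq_sym => /eqP.
  have := lin c 1 0; rewrite th1 th0 scaler0 !addr0.
  by rewrite -mul_mpolyC mulr1.
have [dlin dleib] := derivationP (coords theta).
have dC (c : C) : deriv (coords theta) c%:MP = 0.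
  by rewrite /deriv big1 // => i _; rewrite mderivC mulr0.
apply: mpoly_alg_ind => [c|i|f g Ef Eg|f g Ef Eg].
- by rewrite thC dC.
- by have /rowP /(_ i) := coordsK (coords theta); rewrite !mxE.
- have := dlin 1 f g; rewrite !scale1r => ->.
  by rewrite thD -Ef -Eg.
by rewrite leib -Ef -Eg; apply: dleib.
Qed.

Lemma deriv_linear c t s : deriv (c *: t + s) = c *: deriv t + deriv s.
Proof.
apply/funext => f; transitivity (c * deriv t f + deriv s f); last by [].
rewrite /deriv mulr_sumr -big_split /=.
by apply: eq_bigr => i _; rewrite !mxE mulrDl mulrA.
Qed.

HB.instance Definition _ := GRing.isLinear.Build S 'rV[S]_3 (S -> S^o) _ deriv
  deriv_linear.

Lemma deriv_comb x y z u v w :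
  deriv (x *: u + y *: v + z *: w) = x *: deriv u + y *: deriv v + z *: deriv w.
Proof. by rewrite !linearD !linearZ. Qed.

Lemma deriv_lin v t : deriv t (lin v) = dot (cst v) t.
Proof.
have [dlin _] := derivationP t.
have dX i : deriv t 'X_i = t 0 i by have /rowP /(_ i) := coordsK t; rewrite mxE.
have -> : lin v = v 0 o0 *: 'X_o0 + (v 0 o1 *: 'X_o1 + v 0 o2 *: 'X_o2).
  by rewrite /lin /dot !mxE !mul_mpolyC addrA.
have -> : v 0 o2 *: 'X_o2 = v 0 o2 *: 'X_o2 + 0 :> S by rewrite addr0.
have d0 : deriv t 0 = 0 by have := dlin (-1) 0 0; rewrite scaleN1r addNr scaleN1r addNr.
rewrite (dlin _ 'X_o0) (dlin _ 'X_o1) (dlin _ 'X_o2) d0 !dX addr0.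
by rewrite -!mul_mpolyC /dot !mxE addrA.
Qed.

(** * Lines and linear forms *)

Definition evform (v : E) (x : E) : C^o := dot v x.

Lemma evform_is_linear v : linear (evform v).
Proof. by move=> c x y; rewrite /evform dotDr dotZr. Qed.

HB.instance Definition _ v := GRing.isLinear.Build C E C^o _ (evform v)
  (evform_is_linear v).

Definition form v : 'Hom(E, C^o) := linfun (evform v).

Lemma formE v x : form v x = dot v x.
Proof. by rewrite lfunE. Qed.

Lemma mem_form v x : (x \in lker (form v)) = (dot v x == 0).
Proof. by rewrite memv_ker formE. Qed.

Lemma mem_formP v x : reflect (dot v x = 0) (x \in lker (form v)).
Proof. by rewrite mem_form; apply: eqP. Qed.

Definition coefs (alpha : 'Hom(E, C^o)) : E := \row_i (alpha (delta_mx 0 i) : C).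

Lemma mpoly_of_formE alpha : mpoly_of_form alpha = lin (coefs alpha).
Proof. by rewrite /mpoly_of_form sum_ord3 /lin /dot !mxE !mul_mpolyC. Qed.

Lemma form_coefs alpha : form (coefs alpha) = alpha.
Proof.
apply/lfunP => x; rewrite formE.
rewrite [in RHS](row_sum_delta x) linear_sum sum_ord3 /dot !mxE.
by rewrite !linearZ /=; congr (_ + _ + _); apply: mulrC.
Qed.

Lemma coefs_form v : coefs (form v) = v.
Proof.
apply/rowP => i; rewrite mxE formE /dot !mxE.
by move: i; apply: ord3_ind; rewrite /= !(mulr0, mulr1, addr0, add0r).
Qed.

Lemma line_form (H : {vspace E}) : \dim H = 2%N ->
  exists2 v, v != 0 & lker (form v) = H.
Proof.
move=> dH; have := vbasisP H; move: (vbasis H); rewrite dH.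
case/tupleP=> u1 Y; case/tupleP: Y => u2 Y; rewrite tuple0 /= => /andP [/eqP sp fr].
exists (cross u1 u2).
  apply/eqP => c0; move: fr; rewrite free_cons seq1_free span_seq1 => /andP [u12 u20].
  by case/negP: u12; apply/vlineP; apply: cross_eq0_prop.
have dl u : dot (cross u1 u2) u = det3 u u1 u2 by rewrite -det3_dotr -det3_rot.
have u12 : cross u1 u2 != 0.
  apply/eqP => c0; move: fr; rewrite free_cons seq1_free span_seq1 => /andP [/negP u12 u20].
  by apply: u12; apply/vlineP; apply: cross_eq0_prop.
apply/eqP; rewrite eqEsubv; apply/andP; split.
  apply/subvP => x; rewrite mem_form dl => /eqP d.
  have [c [c' ->]] := dep3_comb u12 d.
  by rewrite -sp; apply: rpredD; apply: rpredZ; apply: memv_span; rewrite !inE eqxx ?orbT.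
rewrite -{1}sp; apply/span_subvP => x; rewrite !inE => /orP [] /eqP ->; rewrite mem_form dl.
  by rewrite det3_eql.
by rewrite det3_rot det3_eqr.
Qed.

Lemma lker_form_prop v w : v != 0 -> lker (form w) = lker (form v) ->
  exists c, w = c *: v.
Proof.
move=> v0 E; apply: (cross_eq0_prop v0); apply/eqP; apply: contraT.
move=> /dot_eq1 [u]; rewrite -det3_dotr => d1.
have : cross v u \in lker (form v) by rewrite mem_form -[dot _ _]/(det3 _ _ _) det3_eql.
by rewrite -E mem_form -[dot _ _]/(det3 _ _ _) d1 oner_eq0.
Qed.

Lemma lker_formZ c v w : c != 0 -> w = c *: v -> lker (form w) = lker (form v).
Proof.
move=> c0 Ew; apply/vspaceP => x; transitivity (dot w x == 0); first exact: mem_form.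
transitivity (dot v x == 0); last exact/esym/mem_form.
by rewrite Ew dotZl mulf_eq0 (negPf c0).
Qed.

Section ArrangementForms.
Variables (I : finType) (a : I -> E) (B : {fset {vspace E}}).
Hypothesis a_neq0 : forall i, a i != 0.
Hypothesis a_indep : forall i j, i != j -> cross (a i) (a j) != 0.
Hypothesis aB : forall H, (H \in B) <-> exists i, lker (form (a i)) = H.

Lemma logder_tangent t : logder B (deriv t) <-> tangent a [set: I] t.
Proof.
split=> [[_ D] i _|D].
  have [|g] := D (lker (form (a i))) _ (form (a i)) (erefl _).
    by apply/aB; exists i.
  by rewrite mpoly_of_formE coefs_form deriv_lin => ->; exists g; apply: mulrC.
split; first exact: derivationP.
move=> H /aB [i <-] alpha; rewrite -{1}(form_coefs alpha) => E.
rewrite mpoly_of_formE; have [c ->] := lker_form_prop (a_neq0 i) E.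
have [g Eg] := D i (in_setT i).
by exists g; rewrite deriv_lin linZ cstZ dotZl Eg [g * _]mulrC mulrA.
Qed.

Hypothesis I_gt0 : (0 < #|I|)%N.

(** The derivations [linprod a J * d/dX_k] are the frame to which
    [basis3_of_free] applies. *)
Lemma free_arrangement_saito : free_arrangement B <-> saito a [set: I].
Proof.
set J := [set: I].
have J0 : J != set0 by rewrite -card_gt0 cardsT.
have DC theta : logder B theta -> deriv (coords theta) = theta.
  by case=> /derivK.
split=> [fr|].
  pose e k : S -> S^o := deriv (linprod a J *: delta_mx 0 k).
  have char0 n : n%:R = 0 :> S -> n = 0%N.
    by move/eqP; rewrite -mpolyC_nat mpolyC_eq0 pnatr_eq0 => /eqP.
  have De k : logder B (e k).
    apply/logder_tangent => i iJ; rewrite dotZr (linprodD1 _ iJ).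
    by apply/pdvdMr/pdvdMr/pdvd_refl.
  have eve k : coords (e k) = linprod a J *: delta_mx 0 k by apply: coordsK.
  have HQ theta : logder B theta ->
      linprod a J *: theta = \sum_k coords theta 0 k *: e k.
    move=> /DC <-; rewrite coordsK; set t := coords theta.
    have Et : linprod a J *: t = \sum_k t 0 k *: (linprod a J *: delta_mx 0 k).
      rewrite [in LHS](row_sum_delta t) scaler_sumr; apply: eq_bigr => k _.
      by rewrite !scalerA mulrC.
    transitivity (deriv (linprod a J *: t)); first by rewrite linearZ.
    by rewrite Et linear_sum; apply: eq_bigr => k _; rewrite linearZ.
  have evl c (u w : S -> S^o) i :
      coords (c *: u + w) 0 i = c * coords u 0 i + coords w 0 i by rewrite !mxE.
  have reg (x : S) : x * linprod a J = 0 -> x = 0.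
    by move/eqP; rewrite mulf_eq0 (negPf (linprod_neq0 a_neq0 J)) orbF => /eqP.
  have [b0 [b1 [b2 [D0 D1 D2 span]]]] :=
    basis3_of_free evl (@mulrC S) reg char0 De eve HQ fr.
  have T b : logder B b -> tangent a J (coords b).
    by move=> Db; apply/logder_tangent; rewrite DC.
  apply: (saito_of_basis a_neq0 a_indep J0 (T _ D0) (T _ D1) (T _ D2)).
  move=> t /logder_tangent /span [x Ex]; exists x.
  by rewrite -[LHS]coordsK Ex !linearD !linearZ.
case/(basis_of_saito a_neq0 a_indep) => t1 [t2 [h1 h2 d span]].
apply: (@free_of_basis3 _ _ _ (deriv (euler C)) (deriv t1) (deriv t2)).
- by apply/logder_tangent; apply: tangent_euler.
- exact/logder_tangent.
- exact/logder_tangent.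
- move=> x y z E0.
  have E : 0 = x *: euler C + y *: t1 + z *: t2.
    by rewrite -[RHS]coordsK deriv_comb E0 linear0.
  have zero p q : det3 (0 : 'rV[S]_3) p q = 0 by rewrite /det3 dotC dot0r.
  have [] := det3_subst E; rewrite !zero => /esym/eqP + /esym/eqP + /esym/eqP.
  by rewrite !mulf_eq0 (negPf d) !orbF => /eqP -> /eqP -> /eqP ->.
move=> theta Dt; have := Dt; rewrite -{1}(DC _ Dt) => /logder_tangent /span [x [y [z E]]].
by exists x, y, z; rewrite -(DC _ Dt) E deriv_comb.
Qed.
End ArrangementForms.
End Derivations.

(** * Intersection lattices *)

Section Lattices.
Variable R : realType.
Local Notation C := (R[i]%C).
Local Notation E := 'rV[C]_3.
Implicit Types (A B T : {fset {vspace E}}) (H X Y : {vspace E}).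

Lemma mem_bigcapP T (x : E) :
  reflect (forall H, H \in T -> x \in H) (x \in (\bigcap_(H <- enum_fset T) H)%VS).
Proof.
have -> : (x \in (\bigcap_(H <- enum_fset T) H)%VS) = all (fun H => x \in H) (enum_fset T).
  elim: (enum_fset T) => [|H s IH]; first by rewrite big_nil memvf.
  by rewrite big_cons memv_cap IH.
exact: allP.
Qed.

Lemma latticeP A X : reflect (exists2 T, (T `<=` A)%fset & X = (\bigcap_(H <- enum_fset T) H)%VS)
  (X \in intersection_lattice A).
Proof.
apply: (iffP idP) => [/imfsetP [T /= TA ->]|[T TA ->]].
  by exists T => //; rewrite -fpowersetE.
by apply/imfsetP; exists T; rewrite //= fpowersetE.
Qed.

Lemma fullv_lattice A : fullv \in intersection_lattice A.
Proof.
apply/latticeP; exists fset0; first exact: fsub0set.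
by apply/vspaceP => x; rewrite memvf; apply/esym/mem_bigcapP => H; rewrite in_fset0.
Qed.

Lemma cap_lattice A H H' : H \in A -> H' \in A -> (H :&: H')%VS \in intersection_lattice A.
Proof.
move=> HA HA'; apply/latticeP; exists [fset H; H']%fset.
  by apply/fsubsetP => X; rewrite in_fset2 => /orP [] /eqP ->.
apply/vspaceP => x; rewrite memv_cap; apply/andP/mem_bigcapP => [[xH xH'] X|xs].
  by rewrite in_fset2 => /orP [] /eqP ->.
by split; apply: xs; rewrite in_fset2 eqxx ?orbT.
Qed.

Lemma line_lattice A H : H \in A -> H \in intersection_lattice A.
Proof. by move=> HA; rewrite -[H]capvv; apply: cap_lattice. Qed.

Lemma lattice_sub A X : X \in intersection_lattice A ->
  X = fullv \/ exists2 H, H \in A & (X <= H)%VS.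
Proof.
case/latticeP=> T TA ->; have [->|[H HT]] := fset_0Vmem T.
  by left; apply/vspaceP => x; rewrite memvf; apply/mem_bigcapP => H; rewrite in_fset0.
right; exists H; first exact: (fsubsetP TA).
by apply/subvP => x /mem_bigcapP /(_ H HT).
Qed.

Definition lattice_bottom A (X : intersection_lattice A) :=
  forall Y : intersection_lattice A, lattice_le X Y.

Definition lattice_atom A (X : intersection_lattice A) :=
  ~ lattice_bottom X /\
  forall Y : intersection_lattice A, lattice_le Y X -> Y = X \/ lattice_bottom Y.

Lemma lattice_bottomP A (X : intersection_lattice A) :
  lattice_bottom X <-> val X = fullv.
Proof.
split=> [/(_ [` fullv_lattice A]%fset)|EX Y]; rewrite /lattice_le.
  by move=> sub; apply/eqP; rewrite eqEsubv subvf.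
by rewrite EX subvf.
Qed.

Lemma lattice_atomP A (X : intersection_lattice A) : line_arrangement A ->
  lattice_atom X <-> val X \in A.
Proof.
have dimE : \dim {:E} = 3%N by rewrite dimvf /dim /= mul1n.
move=> hA; have nfull H : H \in A -> H <> fullv.
  by move=> /hA dH EH; rewrite EH dimE in dH.
split=> [[nb min]|XA].
  have [/lattice_bottomP //|[H HA XH]] := lattice_sub (valP X).
  have [|<- //|/lattice_bottomP /nfull []//] := min [` line_lattice HA]%fset.
  exact: XH.
split=> [/lattice_bottomP /nfull []//|Y XY].
have [/lattice_bottomP|[H HA YH]] := lattice_sub (valP Y); first by right.
have {}XY : (val X <= val Y)%VS := XY.
left; apply: val_inj; apply/eqP; rewrite eq_sym eqEdim XY /=.
by apply: leq_trans (dimvS YH) _; rewrite (hA _ HA) (hA _ XA).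
Qed.

Lemma lattice_iso_inv A B : lattice_isomorphic A B -> lattice_isomorphic B A.
Proof.
move=> [f [[g fK gK] fle]]; exists g; split; first by exists f.
by move=> X Y; rewrite -fle !gK.
Qed.

(** The lines are the atoms, and a line contains the intersection of two others
    exactly when it lies above each lower bound of theirs. *)
Lemma lattice_iso_lines A B : line_arrangement A -> line_arrangement B ->
  lattice_isomorphic A B -> exists f : A -> {vspace E},
  [/\ injective f, forall H, (H \in B) <-> exists i, f i = H &
      forall i j k, (f i :&: f j <= f k)%VS = (val i :&: val j <= val k)%VS].
Proof.
move=> hA hB [phi [bij phile]].
have [psi phiK psiK] := bij.
have bot (X : intersection_lattice A) : lattice_bottom X <-> lattice_bottom (phi X).
  split=> bX Y; first by rewrite -[Y]psiK phile.
  by rewrite -phile.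
have atom (X : intersection_lattice A) : lattice_atom X <-> lattice_atom (phi X).
  split=> -[nb min]; split=> [/bot //|Y].
  - rewrite -[Y]psiK phile => /min [->|/bot]; first by left.
    by rewrite psiK; right.
  - rewrite -phile => /min [/(bij_inj bij) ->|/bot]; first by left.
    by right.
pose inc (i : A) : intersection_lattice A := [` line_lattice (valP i)]%fset.
have atomf i : val (phi (inc i)) \in B.
  by apply/(lattice_atomP _ hB)/atom/(lattice_atomP _ hA); exact: (valP i).
exists (fun i => val (phi (inc i))); split.
- move=> i j /val_inj /(bij_inj bij) /(congr1 val) /=; exact: val_inj.
- move=> H; split=> [HB|[i <-]]; last exact: atomf.
  have HX := line_lattice HB.
  have aX : val (psi [` HX]%fset) \in A.
    by apply/(lattice_atomP _ hA)/atom; rewrite psiK; apply/(lattice_atomP _ hB).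
  exists [` aX]%fset; rewrite (_ : inc _ = psi [` HX]%fset) ?psiK //.
  exact: val_inj.
have cap_iff A' (i j k : intersection_lattice A') : line_arrangement A' ->
    val i \in A' -> val j \in A' ->
    (val i :&: val j <= val k)%VS <->
    forall X : intersection_lattice A', lattice_le i X -> lattice_le j X -> lattice_le k X.
  move=> hA' iA jA; split=> [sub X iX jX|H].
    apply: subv_trans sub; rewrite subv_cap; apply/andP; split; [exact: iX|exact: jX].
  by apply: (H [` cap_lattice iA jA]%fset); rewrite /lattice_le ?capvSl ?capvSr.
move=> i j k; apply/idP/idP.
  move/(cap_iff _ (phi (inc i)) (phi (inc j)) (phi (inc k)) hB (atomf i) (atomf j)) => H.
  apply/(cap_iff _ (inc i) (inc j) (inc k) hA (valP i) (valP j)) => X iX jX.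
  by rewrite -phile; apply: H; rewrite phile.
move/(cap_iff _ (inc i) (inc j) (inc k) hA (valP i) (valP j)) => H.
apply/(cap_iff _ (phi (inc i)) (phi (inc j)) (phi (inc k)) hB (atomf i) (atomf j)).
by move=> X; rewrite -[X]psiK !phile; apply: H.
Qed.

(** * Terao's conjecture *)

Lemma conc_cap (I : finType) (a : I -> E) i j k :
  (forall i, a i != 0) ->
  (forall i j, i != j -> cross (a i) (a j) != 0) -> i != j ->
  conc a i j k =
  (lker (form (a i)) :&: lker (form (a j)) <= lker (form (a k)))%VS.
Proof.
move=> a0 aI ij; apply/eqP/subvP => [d x|sub].
  case/memv_capP => /mem_formP xi /mem_formP xj; apply/mem_formP.
  have d' : det3 (a k) (a i) (a j) = 0 by rewrite det3_rot.
  have [c [c' ->]] := dep3_comb (aI _ _ ij) d'.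
  by rewrite dotC dotDr !dotZr ![dot x _]dotC xi xj !mulr0 addr0.
rewrite det3_dotr dotC; apply/mem_formP/sub/memv_capP.
by split; apply/mem_formP; rewrite -[dot _ _]/(det3 _ _ _) ?det3_eql // det3_rot det3_eqr.
Qed.

Lemma line_forms A B : line_arrangement A -> line_arrangement B ->
  lattice_isomorphic A B -> exists a : A -> E,
  [/\ forall i, a i != 0, forall i j, i != j -> cross (a i) (a j) != 0,
      forall H, (H \in B) <-> exists i, lker (form (a i)) = H &
      forall i j k, i != j -> conc a i j k = (val i :&: val j <= val k)%VS].
Proof.
move=> hA hB /(lattice_iso_lines hA hB) [f [finj fB fcap]].
have : forall i, exists v : E, v != 0 /\ lker (form v) = f i.
  move=> i; have /hB /line_form [v v0 Ev] : f i \in B by apply/fB; exists i.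
  by exists v.
case/fin_all_exists => a Ha.
have a0 i : a i != 0 by case: (Ha i).
have Ea i : lker (form (a i)) = f i by case: (Ha i).
have aI i j : i != j -> cross (a i) (a j) != 0.
  move=> ij; apply/eqP => /(cross_eq0_prop (a0 j)) [c Ec].
  have c0 : c != 0 by apply: contraNneq (a0 i) => c0; rewrite Ec c0 scale0r.
  case/eqP: ij; apply: finj; rewrite -!Ea; exact: lker_formZ c0 Ec.
exists a; split=> // [H|i j k ij].
  by rewrite fB; split=> -[i Ei]; exists i; rewrite ?Ea // -Ea.
by rewrite (conc_cap _ a0 aI ij) !Ea fcap.
Qed.

Lemma multiplicityE A (p : {vspace E}) :
  multiplicity A p = #|[set i : A | (p <= val i)%VS]|.
Proof.
rewrite /multiplicity -(@card_fsub _ A); last first.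
  by apply/fsubsetP => H; rewrite !finmap.inE => /andP [].
by apply: eq_card => i; rewrite in_fsub finset.in_set !finmap.inE (valP i).
Qed.

Lemma cap_lines (p H H' : {vspace E}) : \dim p = 1%N -> \dim H = 2%N -> \dim H' = 2%N ->
  H != H' -> (p <= H)%VS -> (p <= H')%VS -> (H :&: H')%VS = p.
Proof.
move=> dp dH dH' ne pH pH'; apply/esym/eqP; rewrite eqEdim subv_cap pH pH' dp /=.
rewrite leqNgt; apply: contra ne => d2.
have /eqP <- : (H :&: H')%VS == H by rewrite eqEdim capvSl dH.
by rewrite eqEdim capvSr dH'.
Qed.
End Lattices.

Theorem proposition7p4 (R : realType) (A : {fset {vspace 'rV[R[i]%C]_3}})
    (hA : line_arrangement A)
    (hp : exists p : {vspace 'rV[R[i]%C]_3},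
        intersection_point A p /\
        2%:R^-1 * (#|` A|%:R - 3%:R) < (multiplicity A p)%:R :> rat) :
  forall B B' : {fset {vspace 'rV[R[i]%C]_3}},
    line_arrangement B -> line_arrangement B' ->
    lattice_isomorphic B A -> lattice_isomorphic B' A ->
    free_arrangement B -> free_arrangement B'.
Proof.
move=> B B' hB hB' isoB isoB'.
have [p [[dp mp] lt]] := hp.
have [a [a0 aI aB aC]] := line_forms hA hB (lattice_iso_inv isoB).
have [b [b0 bI bB bC]] := line_forms hA hB' (lattice_iso_inv isoB').
rewrite multiplicityE in mp lt.
have /card_gt1P [i0 [j0 [i0p j0p ij0]]] := mp.
rewrite !inE in i0p j0p.
have capp : (val i0 :&: val j0)%VS = p.
  apply: (cap_lines dp (hA _ (valP i0)) (hA _ (valP j0)) _ i0p j0p).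
  by rewrite (inj_eq val_inj).
have EP : pencil a i0 j0 [set: A] = [set i : A | (p <= val i)%VS].
  by apply/setP => i; rewrite !inE /= aC // capp.
have I0 : (0 < #|{: A}|)%N by apply/card_gt0P; exists i0.
move/(free_arrangement_saito a0 aI aB I0) => HB.
apply/(free_arrangement_saito b0 bI bB I0).
have abC i j k : conc a i j k = conc b i j k.
  have [->|ij] := eqVneq i j; last by rewrite aC ?bC.
  by rewrite /conc !det3_eql.
have small : (#|[set: A]| <= 2 * #|pencil a i0 j0 [set: A]| + 2)%N.
  rewrite EP cardsT -cardfE.
  move: lt; set n := size _; set m := #|_| => lt.
  have : n%:R < (2 * m + 3)%:R :> rat by rewrite natrD natrM; lra.
  by rewrite ltr_nat; clear; lia.
exact: (saito_combinatorial a0 b0 aI bI abC ij0 (in_setT _) small HB).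
Qed.
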